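(* Let $p\ge1$ be an integer and let $f:\mathbb{R}^n\to\mathbb{R}$ be a convex, $p$ times differentiable function whose $p$-th derivative is Lipschitz continuous with constant $M_p>0$, i.e. $\|\nabla^p f(x)-\nabla^p f(y)\|_2\le M_p\|x-y\|_2$ for all $x,y\in\mathbb{R}^n$. Let $2\le q\le p+1$ and assume $f$ is uniformly convex of degree $q$: there is $\sigma_q>0$ with $$f(y)\ge f(x)+\langle\nabla f(x),y-x\rangle+\frac{\sigma_q}{q}\|y-x\|_2^q\qquad\text{for all }x,y\in\mathbb{R}^n.$$ Let $x_*$ be the minimizer of $f$, $f^*=f(x_* )$, and let $z_0\in\mathbb{R}^n$ and $\Delta_0$ satisfy $f(z_0)-f^*\le\Delta_0$. Let the sequence $z_k$, $k\ge0$, be generated by the Restarted Optimal Tensor Method (described in the context). Then, for every $k\ge 0$, $$\frac{\sigma_q}{q}\|z_k-x_*\|_2^q\le f(z_k)-f^*\le\Delta_0\cdot2^{-k},$$ and the total number of steps of the Optimal Tensor Method performed to obtain $z_k$, namely $\sum_{i=0}^{k-1}N_i$, is bounded by $$\left(2c\,q^{\frac{p+1}{q}}\right)^{\frac{2}{3p+1}}\frac{M_p^{\frac{2}{3p+1}}}{\sigma_q^{\frac{2(p+1)}{q(3p+1)}}}\,(\Delta_0)^{\frac{2(p+1-q)}{q(3p+1)}}\cdot\sum_{i=0}^k2^{-i\frac{2(p+1-q)}{q(3p+1)}}+k,\qquad c=\frac{2^{\frac{3(p+1)^2+4}{4}}(p+1)}{p!}.$$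
   Context: $\|\cdot\|_2$ is the Euclidean norm on $\mathbb{R}^n$. $\nabla^r f(x)[h_1,\dots,h_r]$ denotes the $r$-th directional derivative of $f$ at $x$ along $h_1,\dots,h_r$ (for $r=0$ it is $f(x)$), and the norm of a symmetric $p$-linear form is $\|\nabla^p f(x)\|_2=\max\{\nabla^p f(x)[h_1,\dots,h_p]:\|h_i\|_2\le 1,\ i=1,\dots,p\}$ (likewise for the difference $\nabla^p f(x)-\nabla^p f(y)$). For a function $g$, an integer $p\ge1$, and $M\ge 0$, $T^{g}_{p,M}(x)$ denotes a point of $$\operatorname{Arg}\min_{y\in\mathbb{R}^n}\left\{\sum_{r=0}^p\frac{1}{r!}\nabla^r g(x)[\underbrace{y-x,\dots,y-x}_{r}]+\frac{M}{(p+1)!}\|y-x\|_2^{p+1}\right\}.$$ For $L\ge0$ and $z\in\mathbb{R}^n$, put $F_{L,z}(x)=f(x)+\frac{L}{2}\|x-z\|_2^2$. Optimal Tensor Method, started from a point $y^0$ and run for $N$ steps. Set $u^0=y^0$ and $A_0=0$. For $k=0,1,\dots,N-1$: choose $L_k>0$ such that $$\frac12\le\frac{2(p+1)M_p}{p!\,L_k}\|y^{k+1}-x^k\|_2^{p-1}\le 1,$$ where $a_{k+1},A_{k+1},x^k,y^{k+1}$ are determined by $L_k$ via $$a_{k+1}=\frac{1/L_k+\sqrt{1/L_k^2+4A_k/L_k}}{2},\qquad A_{k+1}=A_k+a_{k+1},$$ $$x^k=\frac{A_k}{A_{k+1}}y^k+\frac{a_{k+1}}{A_{k+1}}u^k,\qquad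 y^{k+1}=T^{F_{L_k,x^k}}_{p,pM_p}(x^k);$$ then set $u^{k+1}=u^k-a_{k+1}\nabla f(y^{k+1})$. The output is $y^N$. Restarted Optimal Tensor Method. Given $z_0$ and $\Delta_0$ with $f(z_0)-f^*\le\Delta_0$, for $k=0,1,\dots$ set $$\Delta_k=\Delta_0\cdot2^{-k},\qquad N_k=\max\left\{\left\lceil\left(\frac{2cM_p\,q^{\frac{p+1}{q}}}{\sigma_q^{\frac{p+1}{q}}}\Delta_k^{\frac{p+1-q}{q}}\right)^{\frac{2}{3p+1}}\right\rceil,1\right\},\qquad c=\frac{2^{\frac{3(p+1)^2+4}{4}}(p+1)}{p!},$$ and let $z_{k+1}$ be the output $y^{N_k}$ of the Optimal Tensor Method started from $z_k$ and run for $N_k$ steps. *)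

(* Defs.v *)
From HB Require Import structures.
From mathcomp Require Import all_boot all_order all_algebra.
From mathcomp Require Import all_classical all_reals all_analysis.
Set Implicit Arguments.
Unset Strict Implicit.
Unset Printing Implicit Defensive.
Import Order.TTheory GRing.Theory Num.Theory.
Import numFieldNormedType.Exports.
Local Open Scope classical_set_scope.
Local Open Scope ring_scope.

Section Calculus.
Context {R : realType} {n : nat}.
Local Notation V := 'rV[R]_n.
Implicit Types (f : V -> R) (x y h : V).

Definition dot x y : R := \sum_(i < n) x ord0 i * y ord0 i.

(* The library norm on row vectors is the max norm; it is only used below
   through the topology it induces. *)
Definition enorm x : R := Num.sqrt (dot x x).

Definition grad f x : V := \row_(i < n) 'D_(delta_mx ord0 i) f x.

(* nabla f [:: h1; ...; hr] x is the r-th directional derivative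
   D_{hr} ... D_{h1} f at x. *)
Definition nabla f (hs : seq V) : V -> R := foldl (fun g h => 'D_h g) f hs.

(* Frechet differentiability of order p on the whole space. As V has finite
   dimension, the derivative of f, a map from V to linear forms, is p times
   differentiable iff its evaluation at each vector h is. *)
Fixpoint times_differentiable (p : nat) f : Prop :=
  if p is p'.+1 then
    (forall x, differentiable f x) /\ (forall h, times_differentiable p' ('D_h f))
  else True.

(* Valued in the extended reals, so that the supremum carries no default value;
   it is a maximum for multilinear forms. *)
Definition form_norm (p : nat) (phi : p.-tuple V -> R) : \bar R :=
  ereal_sup [set (phi h)%:E | h in
    [set h : p.-tuple V | forall i, enorm (tnth h i) <= 1]].

Definition lipschitz_nabla (p : nat) (M : R) f : Prop :=
  forall x y,
    (form_norm (fun h : p.-tuple V => nabla f h x - nabla f h y)%R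
       <= (M * enorm (x - y))%:E)%E.

Definition uniformly_convex (q sigma : R) f : Prop :=
  forall x y,
    f x + dot (grad f x) (y - x) + sigma / q * enorm (y - x) `^ q <= f y.

End Calculus.

Section TensorMethod.
Context {R : realType} {n : nat}.
Local Notation V := 'rV[R]_n.

Definition taylor_model (g : V -> R) (p : nat) (M : R) (x y : V) : R :=
  \sum_(r < p.+1) (r`!%:R)^-1 * nabla g (nseq r (y - x)) x
  + M / (p.+1)`!%:R * enorm (y - x) ^+ p.+1.

(* y is a possible value of T^g_{p,M}(x) *)
Definition is_tensor_step (g : V -> R) (p : nat) (M : R) (x y : V) : Prop :=
  forall y', taylor_model g p M x y <= taylor_model g p M x y'.

Definition regularized (f : V -> R) (L : R) (z : V) : V -> R :=
  fun x => f x + L / 2 * enorm (x - z) ^+ 2.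

(* The sequences form a run of N steps from y0; their values at indices that
   the N steps do not reach are irrelevant. *)
Definition optimal_tensor_run (f : V -> R) (p : nat) (M : R) (N : nat) (y0 : V)
    (L a A : nat -> R) (x y u : nat -> V) : Prop :=
  [/\ y 0%N = y0, u 0%N = y0, A 0%N = 0 &
    forall k, (k < N)%N ->
      [/\ 0 < L k /\
            2^-1 <= 2 * p.+1%:R * M / (p`!%:R * L k)
                      * enorm (y k.+1 - x k) ^+ p.-1 <= 1,
          a k.+1 = ((L k)^-1 + Num.sqrt ((L k)^-1 ^+ 2 + 4 * A k / L k)) / 2 /\
            A k.+1 = A k + a k.+1,
          x k = (A k / A k.+1) *: y k + (a k.+1 / A k.+1) *: u k,
          is_tensor_step (regularized f (L k) (x k)) p (p%:R * M) (x k) (y k.+1)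
        & u k.+1 = u k - a k.+1 *: grad f (y k.+1)]].

Definition optimal_tensor_output (f : V -> R) (p : nat) (M : R) (N : nat)
    (y0 yN : V) : Prop :=
  exists (L a A : nat -> R) (x y u : nat -> V),
    optimal_tensor_run f p M N y0 L a A x y u /\ yN = y N.

End TensorMethod.

Section Restart.
Context {R : realType}.

Definition rate_const (p : nat) : R :=
  2 `^ ((3 * p.+1%:R ^+ 2 + 4) / 4) * p.+1%:R / p`!%:R.

Definition gap_bound (Delta0 : R) (k : nat) : R := Delta0 * 2 ^- k.

Definition restart_steps (p : nat) (M q sigma Delta0 : R) (k : nat) : nat :=
  `| Num.max
      (Num.ceil
        ((2 * rate_const p * M * q `^ (p.+1%:R / q) / sigma `^ (p.+1%:R / q)
           * gap_bound Delta0 k `^ ((p.+1%:R - q) / q))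
         `^ (2 / (3 * p + 1)%:R)))
      1 |%N.

Definition restarted_tensor_run (n : nat) (f : 'rV[R]_n -> R) (p : nat)
    (M q sigma Delta0 : R) (z : nat -> 'rV[R]_n) : Prop :=
  forall k, optimal_tensor_output f p M (restart_steps p M q sigma Delta0 k)
              (z k) (z k.+1).

End Restart.

(* Main.v *)
Require Import Defs.
From HB Require Import structures.
From mathcomp Require Import all_boot all_order all_algebra.
From mathcomp Require Import all_classical all_reals all_analysis.
From mathcomp Require Import ring lra zify.
Import Order.TTheory GRing.Theory Num.Theory.
Import numFieldNormedType.Exports.
Local Open Scope classical_set_scope.
Local Open Scope ring_scope.
Set Implicit Arguments.
Unset Strict Implicit.
Unset Printing Implicit Defensive.

(** The proof has two layers: a rate for one run of the optimal tensor method
    on a smooth convex function, and a halving argument for the restarts.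

    One run.  A tensor step for [regularized f L x] is a global minimizer of a
    Taylor model, so its first-order optimality condition, compared with the
    Taylor expansion of the directional derivatives of the function at the new
    point, shows that the gradient there is of order the p-th power of the step
    length ([tensor_step_derive_le]).  The upper half of the condition on L
    turns this into [prox_tensor_step_residual]: the new point y is an inexact
    proximal point, where grad f y + L (y - x) has norm at most half of
    L |y - x|.  The estimate-sequence argument of Monteiro and Svaiter then
    makes the energy A_k (f y_k - f xs) + |u_k - xs|^2 / 2 decrease by a multiple
    of A_{k+1} L_k |y_{k+1} - x_k|^2 ([energy_step], [run_energy]).  Hence
    f y_N - f xs is at most |y_0 - xs|^2 / (2 A_N), and the weighted sum of the
    L_k |y_{k+1} - x_k|^2 is bounded.  The lower half of the condition on L
    says that L_k is at most a constant times |y_{k+1} - x_k|^(p-1), so a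
    large L_k, which slows the growth of A_k, uses up that budget; Hoelder's
    inequality ([growth_rate]) converts this trade-off into growth of A_N of
    order N^((3p+1)/2), which is [optimal_tensor_rate].

    For p = 1 the Taylor model contains no trace of the quadratic
    regularization, and the new point need not be an inexact proximal point in
    the above sense.  The step is then a gradient step of length 1/M, and
    cocoercivity of the gradient gives the decrease of the energy instead
    ([gradient_progress]); as L lies between 4M and 8M, no trade-off occurs.

    Restarts.  Uniform convexity bounds the distance from z_k to the minimizer
    by a power of the current gap, so the rate bounds the gap after N_k steps
    in terms of the gap before them; N_k is chosen so that
    this bound is at most half of the previous one ([restart_halves]).  Summing
    N_k <= X_k + 1, where X_k is the real number that N_k rounds up, gives the
    total ([sum_restart_steps_le]). *)

(** * Euclidean inner product and norm *)

Section Euclidean.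
Context {R : realType} {n : nat}.
Implicit Types (x y h : 'rV[R]_n) (c : R).

Lemma dotC x y : dot x y = dot y x.
Proof. by apply: eq_bigr => i _; rewrite mulrC. Qed.

Lemma dotDl x y h : dot (x + y) h = dot x h + dot y h.
Proof. by rewrite -big_split /=; apply: eq_bigr => i _; rewrite mxE mulrDl. Qed.

Lemma dotZl c x y : dot (c *: x) y = c * dot x y.
Proof. by rewrite mulr_sumr; apply: eq_bigr => i _; rewrite mxE mulrA. Qed.

Lemma dotNl x y : dot (- x) y = - dot x y.
Proof. by rewrite -scaleN1r dotZl mulN1r. Qed.

Lemma dotBl x y h : dot (x - y) h = dot x h - dot y h.
Proof. by rewrite dotDl dotNl. Qed.

Lemma dotDr x y h : dot h (x + y) = dot h x + dot h y.
Proof. by rewrite dotC dotDl !(dotC h). Qed.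

Lemma dotZr c x y : dot y (c *: x) = c * dot y x.
Proof. by rewrite dotC dotZl (dotC y). Qed.

Lemma dotNr x y : dot y (- x) = - dot y x.
Proof. by rewrite dotC dotNl (dotC y). Qed.

Lemma dotBr x y h : dot h (x - y) = dot h x - dot h y.
Proof. by rewrite dotDr dotNr. Qed.

Definition dotE := (dotDl, dotDr, dotNl, dotNr, dotZl, dotZr).

Lemma dot_ge0 x : 0 <= dot x x.
Proof. by apply: sumr_ge0 => i _; rewrite -expr2 sqr_ge0. Qed.

Lemma dot_eq0 x : dot x x = 0 -> x = 0.
Proof.
move/eqP; rewrite psumr_eq0; last by move=> i _; rewrite -expr2 sqr_ge0.
move=> /allP H; apply/rowP => i; rewrite mxE.
have /= := H i (mem_index_enum _).
by rewrite mulf_eq0 orbb => /eqP.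
Qed.

Lemma enorm_ge0 x : 0 <= enorm x. Proof. exact: sqrtr_ge0. Qed.

Lemma enorm_sqr x : enorm x ^+ 2 = dot x x.
Proof. by rewrite sqr_sqrtr ?dot_ge0. Qed.

Lemma enorm_eq0 x : enorm x = 0 -> x = 0.
Proof. by move=> x0; apply: dot_eq0; rewrite -enorm_sqr x0 expr0n. Qed.

Lemma enormZ c x : enorm (c *: x) = `|c| * enorm x.
Proof.
by rewrite /enorm dotZl dotZr mulrA -expr2 sqrtrM ?sqr_ge0// sqrtr_sqr.
Qed.

Lemma enorm0 : enorm (0 : 'rV[R]_n) = 0.
Proof. by rewrite -(scale0r 0) enormZ normr0 mul0r. Qed.

Lemma enormN x : enorm (- x) = enorm x.
Proof. by rewrite -scaleN1r enormZ normrN1 mul1r. Qed.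

Lemma cauchy_schwarz x y : dot x y <= enorm x * enorm y.
Proof.
have [x0|x0] := eqVneq (enorm x) 0.
  by rewrite (enorm_eq0 x0) -(scale0r 0) dotZl mul0r enormZ normr0 !mul0r.
have [y0|y0] := eqVneq (enorm y) 0.
  by rewrite (enorm_eq0 y0) -(scale0r 0) dotZr mul0r enormZ normr0 mul0r mulr0.
have xgt0 : 0 < enorm x by rewrite lt_def x0 enorm_ge0.
have ygt0 : 0 < enorm y by rewrite lt_def y0 enorm_ge0.
have := dot_ge0 (enorm y *: x - enorm x *: y).
rewrite !dotE (dotC y x) -!enorm_sqr.
rewrite [leRHS](_ : _ = (2 * (enorm x * enorm y)) *
  (enorm x * enorm y - dot x y)); last by ring.
by rewrite pmulr_rge0 ?subr_ge0// mulr_gt0// mulr_gt0.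
Qed.

Lemma enormD x y : enorm (x + y) <= enorm x + enorm y.
Proof.
rewrite -(@ler_pXn2r _ 2)// ?nnegrE ?addr_ge0 ?enorm_ge0//.
rewrite sqrrD !enorm_sqr !dotE (dotC y x) mulr2n.
by have := cauchy_schwarz x y; lra.
Qed.

End Euclidean.

(** * Higher directional derivatives and Taylor's formula *)

Section Directional.
Context {R : realType} {n : nat}.
Local Notation V := 'rV[R]_n.
Implicit Types (f g : V -> R) (x y h s u v : V) (hs : seq V) (c t : R).

Lemma derive_lin g x c u v : differentiable g x ->
  'D_(u + c *: v) g x = 'D_u g x + c * 'D_v g x.
Proof. by move=> dg; rewrite !deriveE// linearD linearZ. Qed.

Lemma deriveZdir g x c v : differentiable g x -> 'D_(c *: v) g x = c * 'D_v g x.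
Proof. by move=> dg; rewrite !deriveE// linearZ. Qed.

Lemma deriveNdir g x v : differentiable g x -> 'D_(- v) g x = - 'D_v g x.
Proof. by move=> dg; rewrite -scaleN1r deriveZdir// mulN1r. Qed.

Lemma derive_linfun f g c x h : differentiable f x -> differentiable g x ->
  'D_h (fun x => f x + c * g x) x = 'D_h f x + c * 'D_h g x.
Proof.
move=> df dg; have := @deriveD _ _ _ f (c *: g) x h.
by rewrite deriveZ; [apply|]; try exact: diff_derivable;
  apply/derivableZ/diff_derivable.
Qed.

Lemma differentiable_lin f g c x : differentiable f x -> differentiable g x ->
  differentiable (fun x => f x + c * g x) x.
Proof.
by move=> df dg; exact: (differentiableD df (differentiableZ c dg)).
Qed.

(** Restricting to a line reduces questions about directional derivatives to
    one-variable calculus; this is how all later mean value and optimality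
    arguments start. *)
Lemma is_derive_line g x s t : differentiable g (x + t *: s) ->
  is_derive t 1 (fun t => g (x + t *: s)) ('D_s g (x + t *: s)).
Proof.
move=> dg; have E : (fun k : R => k^-1 *: (g (x + (k *: 1 + t) *: s) - g (x + t *: s)))
    = (fun k : R => k^-1 *: (g (k *: s + (x + t *: s)) - g (x + t *: s))).
  apply/funext => k; congr (_ *: (g _ - _)).
  by rewrite [k *: 1]mulr1 scalerDl addrCA.
have cg : derivable g (x + t *: s) s by exact: diff_derivable.
split.
  by rewrite /derivable /= E.
by rewrite /derive /= E.
Qed.

Lemma times_differentiable_differentiable p g x : (0 < p)%N ->
  times_differentiable p g -> differentiable g x.
Proof. by case: p => // p _ [+ _]; apply. Qed.

Lemma times_differentiable_le r p g : (r <= p)%N ->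
  times_differentiable p g -> times_differentiable r g.
Proof.
elim: r p g => [//|r IH] [//|p] g rp [dg Dg]; split=> // h.
exact: IH (Dg h).
Qed.

Lemma times_differentiable_lin p f g c : times_differentiable p f ->
  times_differentiable p g -> times_differentiable p (fun x => f x + c * g x).
Proof.
elim: p f g => [//|p IH] f g [df Df] [dg Dg]; split=> [x|h].
  exact: differentiable_lin.
rewrite [X in times_differentiable _ X](_ : _ = fun x => 'D_h f x + c * 'D_h g x).
  exact: (IH _ _ (Df h) (Dg h)).
by apply/funext => x; exact: derive_linfun.
Qed.

Lemma nabla_lin f g c hs x : times_differentiable (size hs) f ->
  times_differentiable (size hs) g ->
  nabla (fun x => f x + c * g x) hs x = nabla f hs x + c * nabla g hs x.
Proof.
elim: hs f g => [//|h hs IH] f g [df Df] [dg Dg] /=.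
rewrite -(IH _ _ (Df h) (Dg h)); congr (foldl _ _ _ _).
by apply/funext => y; exact: derive_linfun.
Qed.

Lemma nablaZ f c hs x : times_differentiable (size hs) f ->
  nabla (fun x => c * f x) hs x = c * nabla f hs x.
Proof.
elim: hs f => [//|h hs IH] f [df Df] /=; rewrite -(IH _ (Df h)); congr (foldl _ _ _ _).
by apply/funext => y; rewrite -[LHS]/('D_h (c *: f) y) deriveZ//;
  exact: diff_derivable.
Qed.

(** The little-o of the differential in epsilon form, for the max norm that
    defines the topology. *)
Lemma diff_remainder g x : differentiable g x -> forall e : R, 0 < e ->
  exists2 d, 0 < d & forall w, `|w| < d ->
    `|g (x + w) - g x - 'd g x w| <= e * `|w|.
Proof.
move=> dg e e0; have /eqaddoP/(_ e e0) := diff_locally dg.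
move=> /nbhs_ballP[d /= d0 B]; exists d => // w wd.
have := B w; rewrite -ball_normE /= sub0r normrN => /(_ wd).
rewrite !fctE /= opprD addrA (addrC w x).
by rewrite /cst.
Qed.

(** The second difference is the increment, as the first offset grows from 0
    to t h, of the first difference along t s; the mean value theorem turns it
    into an increment of 'D_h g, which differentiability at x evaluates. *)
Lemma second_difference g x h s : (forall y, differentiable g y) ->
  differentiable ('D_h g) x -> forall e : R, 0 < e ->
  exists2 d, 0 < d & forall t, 0 < t < d ->
    `|g (x + t *: h + t *: s) - g (x + t *: h) - g (x + t *: s) + g x
      - t ^+ 2 * 'D_s ('D_h g) x| <= e * t ^+ 2.
Proof.
move=> dg dDh e e0.
pose c := 2 * `|h| + `|s| + 1.
have c0 : 0 < c by rewrite /c; have := normr_ge0 h; have := normr_ge0 s; lra.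
have [d d0 B] := diff_remainder dDh (divr_gt0 e0 c0).
exists (d / c); first exact: divr_gt0.
move=> t /andP[t0]; rewrite ltr_pdivlMr// => tc.
(* psi is the first difference along t s with base point x + th h. *)
pose psi := (fun th : R => g (x + t *: s + th *: h) - g (x + th *: h)).
have dpsi (th : R) : is_derive th (1 : R) psi
   ('D_h g (x + t *: s + th *: h) - 'D_h g (x + th *: h)).
  by apply: is_deriveB; exact: is_derive_line.
have cpsi : {within `[0, t], continuous psi}.
  apply: derivable_within_continuous => th _.
  by have := dpsi th => -[].
have [xi] := MVT t0 (fun th _ => dpsi th) cpsi.
rewrite in_itv/= => /andP[xi0 xit]; rewrite subr0 => E.
have -> : g (x + t *: h + t *: s) - g (x + t *: h) - g (x + t *: s) + g x
   = psi t - psi 0.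
  rewrite /psi scale0r !addr0 (addrAC x); ring.
rewrite E.
have nw1 : `|t *: s + xi *: h| <= t * (`|h| + `|s|).
  apply: (le_trans (ler_normD _ _)); rewrite !normrZ !gtr0_norm//.
  by rewrite mulrDr addrC lerD2r ler_wpM2r// ltW.
have nw2 : `|xi *: h| <= t * `|h|.
  by rewrite normrZ gtr0_norm// ler_wpM2r// ltW.
have th0 : 0 <= t * `|h| by rewrite mulr_ge0// ltW.
have ts0 : 0 <= t * `|s| by rewrite mulr_ge0// ltW.
have tcE : t * c = 2 * (t * `|h|) + t * `|s| + t by rewrite /c; ring.
rewrite mulrDr in nw1.
have B1 : `|t *: s + xi *: h| < d by lra.
have B2 : `|xi *: h| < d by lra.
move: {B1 B2} (B _ B1) (B _ B2).
rewrite linearD linearZ /= -(deriveE s dDh) addrA.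
set a := 'd _ _ (xi *: h); set b := 'D_h g _; set b' := 'D_h g (x + xi *: h).
set D := 'D_s _ x; set r := 'D_h g x => B1 B2.
have e'0 : 0 < e / c by exact: divr_gt0.
(* The common value at x cancels, so only the two remainders are left. *)
have B3 : `|b - b' - t * D| <= e * t.
  have -> : b - b' - t * D = (b - r - (t *: D + a)) - (b' - r - a).
    by rewrite /GRing.scale/=; ring.
  apply: (le_trans (ler_normB _ _)); apply: (le_trans (lerD B1 B2)).
  rewrite -mulrDr.
  have -> : e * t = e / c * (t * c) by field; rewrite gt_eqF.
  by rewrite ler_pM2l//; lra.
have -> : (b - b') * t - t ^+ 2 * D = t * (b - b' - t * D) by ring.
rewrite normrM gtr0_norm// expr2 mulrCA.
by rewrite ler_pM2l.
Qed.

(** Symmetry of second derivatives: the second difference is symmetric in h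
    and s, and both mixed derivatives are its limit after division by t^2. *)
Lemma derive_swap g x h s : (forall y, differentiable g y) ->
  differentiable ('D_h g) x -> differentiable ('D_s g) x ->
  'D_s ('D_h g) x = 'D_h ('D_s g) x.
Proof.
move=> dg dh ds; apply/eqP; rewrite -subr_eq0 -normr_le0; apply/ler_addgt0Pr => e e0.
have e20 : 0 < e / 2 by exact: divr_gt0.
have [d1 d10 B1] := second_difference s dg dh e20.
have [d2 d20 B2] := second_difference h dg ds e20.
pose t := Num.min d1 d2 / 2.
have m0 : 0 < Num.min d1 d2 by rewrite lt_min d10.
have t0 : 0 < t by exact: divr_gt0.
have td : t < Num.min d1 d2 by rewrite /t; lra.
move: td; rewrite lt_min => /andP[td1 td2].
have := B1 t; rewrite t0 td1 => /(_ isT) {}B1.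
have := B2 t; rewrite t0 td2 => /(_ isT) {}B2.
rewrite (addrAC x (t *: s)) in B2.
have t2 : 0 < t ^+ 2 by exact: exprn_gt0.
rewrite add0r -(@ler_pM2l _ (t ^+ 2))// -{1}(gtr0_norm t2) -normrM.
move: B1 B2; set D1 := 'D_s _ x; set D2 := 'D_h _ x.
set X := g (x + _ + _); set Y1 := g (x + _ *: h); set Y2 := g (x + _ *: s).
move: D1 D2 X Y1 Y2 (g x) {td1 td2 m0 t0 dg dh ds} (t) t2 => {t} D1 D2 X Y1 Y2 Y t t2.
rewrite !ler_norml => /andP[? ?] /andP[? ?].
by apply/andP; split; lra.
Qed.

Lemma derive_swapfun g h s : times_differentiable 2 g ->
  'D_s ('D_h g) = 'D_h ('D_s g).
Proof.
case=> dg Dg; apply/funext => x.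
by apply: derive_swap => //; [case: (Dg h) | case: (Dg s)].
Qed.

(** The derivative of a symmetric (r+1)-form on the diagonal is r+1 times the
    form with one slot filled by h.  The induction peels off the first slot of
    the form, so symmetry enters only as the exchange of two adjacent derivatives. *)
Lemma is_derive_nabla_diag r g s h x : times_differentiable r.+1 g ->
  is_derive (0 : R) (1 : R) (fun t : R => nabla g (nseq r.+1 (s + t *: h)) x)
    (r.+1%:R * nabla ('D_h g) (nseq r s) x).
Proof.
elim: r g => [|r IH] g tg.
  have -> : (fun t : R => nabla g (nseq 1 (s + t *: h)) x) =
            (fun t : R => 'D_s g x + t * 'D_h g x).
    apply/funext => t /=; apply: derive_lin.
    exact: times_differentiable_differentiable tg.
  apply: is_derive_eq.
  by rewrite /GRing.scale/= mulr0 !add0r mulr1 mul1r.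
have [dg Dg] := tg.
have -> : (fun t : R => nabla g (nseq r.+2 (s + t *: h)) x) =
          (fun t : R => nabla ('D_s g) (nseq r.+1 (s + t *: h)) x
                      + t * nabla ('D_h g) (nseq r.+1 (s + t *: h)) x).
  apply/funext => t; rewrite -nabla_lin ?size_nseq; [|exact: Dg|exact: Dg].
  rewrite -[LHS]/(nabla ('D_(s + t *: h) g) (nseq r.+1 (s + t *: h)) x).
  congr (nabla _ _ _); apply/funext => y; exact: derive_lin.
have I1 := IH _ (Dg s); have I2 := IH _ (Dg h).
have I0 := is_derive_id (0 : R) (1 : R).
apply: (is_derive_eq (is_deriveD I1 (is_deriveM I0 I2))).
rewrite !scale0r addr0 add0r [_%:A]mulr1.
rewrite -(@derive_swapfun g h s).
  by rewrite -[in RHS]nat1r mulrDl mul1r addrC.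
split=> // v; have := Dg v; case=> + _; split => //.
Qed.

End Directional.

Section Taylor.
Context {R : realType}.

Lemma is_derive_monomial (a : R) k (u : R) :
  is_derive u (1 : R) (fun u : R => a * u ^+ k) (a * (k%:R * u ^+ k.-1)).
Proof.
have H := is_deriveZ a (derivableP (@exprn_derivable _ k u (1 : R))).
apply: (@is_derive_eq _ _ _ (a *: (@GRing.exp R ^~ k)) _ _ _ _ H).
by rewrite exp_derive /GRing.scale/= mulr1.
Qed.

Lemma is_derive_affineX (C a b : R) k :
  is_derive (0 : R) (1 : R) (fun t : R => C * (a + t * b) ^+ k.+1)
    (C * (k.+1%:R * a ^+ k * b)).
Proof.
have lin : is_derive (0 : R) (1 : R) (fun t : R => a + t * b) b.
  have -> : (fun t : R => a + t * b) = (fun t : R => cst a t + b * t ^+ 1).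
    by apply/funext => t; rewrite expr1 mulrC.
  apply: (is_derive_eq (is_deriveD (is_derive_cst _ _ _) (is_derive_monomial b 1 0))).
  by rewrite add0r !mulr1.
have H := is_deriveZ C (is_deriveX k.+1 lin).
have -> : (fun t : R => C * (a + t * b) ^+ k.+1) =
  C \*: ((fun t : R => a + t * b) ^+ k.+1) by apply/funext => t; rewrite !fctE.
apply: (is_derive_eq H).
by rewrite /GRing.scale/= mul0r addr0.
Qed.

(** Integration of a bound on the derivative, one degree at a time; this is the
    inductive step of Taylor's formula. *)
Lemma norm_le_of_derive (phi dphi : R -> R) (C : R) k :
  (forall t : R, is_derive t (1 : R) phi (dphi t)) -> phi 0 = 0 ->
  (forall t, 0 <= t -> `|dphi t| <= C * t ^+ k / k`!%:R) ->
  forall t, 0 <= t -> `|phi t| <= C * t ^+ k.+1 / k.+1`!%:R.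
Proof.
move=> dphiE phi0 H.
suff main (psi dpsi : R -> R) : (forall t : R, is_derive t (1 : R) psi (dpsi t)) ->
    psi 0 = 0 -> (forall t, 0 <= t -> dpsi t <= C * t ^+ k / k`!%:R) ->
    forall t, 0 <= t -> psi t <= C * t ^+ k.+1 / k.+1`!%:R.
  move=> t t0; rewrite ler_norml; apply/andP; split.
    rewrite lerNl; apply: (main (fun t => - phi t) (fun t => - dphi t)) => //.
    - by rewrite phi0 oppr0.
    - by move=> u u0; have := H u u0; rewrite ler_norml => /andP[]; lra.
  apply: (main phi dphi) => // u u0; exact: (le_trans (ler_norm _) (H u u0)).
move=> dpsiE psi0 {}H t; rewrite le_eqVlt => /predU1P[<-|t0].
  by rewrite psi0 expr0n mulr0 mul0r.
pose chi (u : R) := C / k.+1`!%:R * u ^+ k.+1 - psi u.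
have dchi (u : R) : is_derive u (1 : R) chi (C * u ^+ k / k`!%:R - dpsi u).
  rewrite /chi.
  apply: (is_derive_eq (is_deriveB (is_derive_monomial _ _ _) (dpsiE u))).
  rewrite factS natrM /=; congr (_ - _); field.
  by rewrite pnatr_eq0 -lt0n fact_gt0 nat1r pnatr_eq0.
have cchi : {within `[0, t], continuous chi}.
  apply: derivable_within_continuous => u _.
  by have := dchi u => -[].
have [xi] := MVT t0 (fun u _ => dchi u) cchi.
rewrite in_itv/= => /andP[/ltW xi0 xit]; rewrite subr0 {1 2}/chi.
rewrite psi0 expr0n mulr0 !subr0 => E.
have : 0 <= (C * xi ^+ k / k`!%:R - dpsi xi) * t.
  by rewrite mulr_ge0 ?subr_ge0 ?H// ltW.
by rewrite -E subr_ge0 mulrAC.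
Qed.

Context {n : nat}.
Local Notation V := 'rV[R]_n.

(** Taylor's formula of order m along a line when only the m-th derivative is
    known to be Lipschitz, whence an error of order m+1: differentiating the
    remainder gives the remainder of order m-1 for 'D_s g. *)
Lemma taylor_remainder m (g : V -> R) (x s : V) (K : R) :
  times_differentiable m g ->
  (forall t, 0 <= t ->
    `|nabla g (nseq m s) (x + t *: s) - nabla g (nseq m s) x| <= K * t) ->
  forall t, 0 <= t ->
  `|g (x + t *: s) - \sum_(r < m.+1) t ^+ r / r`!%:R * nabla g (nseq r s) x|
    <= K * t ^+ m.+1 / m.+1`!%:R.
Proof.
elim: m g => [|m IH] g tg H t t0.
  by rewrite big_ord1 expr0 factS fact0 muln1 divr1 mul1r expr1 divr1; exact: H.
have [dg Dg] := tg.
pose phi (t : R) := g (x + t *: s)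
  - \sum_(r < m.+2) t ^+ r / r`!%:R * nabla g (nseq r s) x.
pose dphi (t : R) := 'D_s g (x + t *: s)
  - \sum_(r < m.+1) t ^+ r / r`!%:R * nabla ('D_s g) (nseq r s) x.
apply: (@norm_le_of_derive phi dphi) => //.
- move=> u; have I := is_derive_line (dg (x + u *: s)).
  rewrite /phi; apply: is_deriveB.
  have -> : (fun t : R => \sum_(r < m.+2) t ^+ r / r`!%:R * nabla g (nseq r s) x)
     = (fun t : R => g x + (\sum_(r < m.+1) (fun t : R =>
          nabla g (nseq r.+1 s) x / r.+1`!%:R * t ^+ r.+1)) t).
    apply/funext => v; rewrite big_ord_recl /= expr0 fact0 divr1 mul1r.
    rewrite fct_sumE; congr (_ + _); apply: eq_bigr => r _.
    by rewrite [RHS]mulrC mulrA mulrAC.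
  rewrite -[X in is_derive _ _ _ X]add0r.
  apply: is_deriveD; apply: is_derive_sum => r.
  apply: (is_derive_eq (is_derive_monomial (nabla g (nseq r.+1 s) x / r.+1`!%:R) r.+1 u)).
  rewrite factS natrM /= ; field.
  by rewrite pnatr_eq0 -lt0n fact_gt0 nat1r pnatr_eq0.
- rewrite /phi scale0r addr0 big_ord_recl big1 /=.
    by rewrite expr0 fact0 divr1 mul1r addr0 subrr.
  by move=> r _; rewrite expr0n mul0r mul0r.
- move=> u u0; exact: (IH _ (Dg s)).
Qed.

End Taylor.

(** * The residual of a tensor step *)

Section TensorStep.
Context {R : realType} {n : nat}.
Local Notation V := 'rV[R]_n.
Implicit Types (f g : V -> R) (x y z h s u v w : V) (hs : seq V) (c t M L : R).

Lemma grad_dot f x h : differentiable f x -> dot (grad f x) h = 'D_h f x.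
Proof.
move=> df; rewrite [in RHS](row_sum_delta h) deriveE// linear_sum.
apply: eq_bigr => i _; rewrite linearZ /= -deriveE// mulrC.
by rewrite /grad mxE.
Qed.

(** Writing the vector zero as 0 times a vector of the unit ball lets the
    homogeneity arguments avoid a case distinction. *)
Lemma enorm_normalize x : exists2 e : V, enorm e <= 1 & x = enorm x *: e.
Proof.
have [x0|x0] := eqVneq (enorm x) 0.
  by exists 0; rewrite ?enorm0// x0 scale0r; exact: enorm_eq0.
exists ((enorm x)^-1 *: x); last by rewrite scalerA mulfV// scale1r.
by rewrite enormZ ger0_norm ?invr_ge0 ?enorm_ge0// mulVf.
Qed.

Lemma nabla_nseqZ g p c s x : times_differentiable p g ->
  nabla g (nseq p (c *: s)) x = c ^+ p * nabla g (nseq p s) x.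
Proof.
elim: p g => [|p IH] g tg; first by rewrite expr0 mul1r.
have [dg Dg] := tg.
have -> : nabla g (nseq p.+1 (c *: s)) x
        = nabla (fun x => c * 'D_s g x) (nseq p (c *: s)) x.
  rewrite -[LHS]/(nabla ('D_(c *: s) g) (nseq p (c *: s)) x).
  congr (nabla _ _ _); apply/funext => y; exact: deriveZdir.
rewrite nablaZ ?size_nseq; last exact: Dg.
by rewrite IH; [rewrite mulrA -exprS | exact: Dg].
Qed.

(** The definition of the form norm only speaks of vectors in the unit ball;
    homogeneity in h and s extends the bound to all directions. *)
Lemma lipschitz_nabla_le p M g x y h s : times_differentiable p.+1 g ->
  lipschitz_nabla p.+1 M g ->
  `|nabla g (h :: nseq p s) x - nabla g (h :: nseq p s) y|
    <= M * enorm (x - y) * (enorm h * enorm s ^+ p).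
Proof.
move=> tg lip.
have [h' h'1 Eh] := enorm_normalize h; have [s' s'1 Es] := enorm_normalize s.
have [dg Dg] := tg.
have E z a b : nabla g (a *: h' :: nseq p (b *: s')) z =
    a * b ^+ p * nabla g (h' :: nseq p s') z.
  have -> : nabla g (a *: h' :: nseq p (b *: s')) z =
      nabla (fun x => a * 'D_h' g x) (nseq p (b *: s')) z.
    rewrite -[LHS]/(nabla ('D_(a *: h') g) (nseq p (b *: s')) z).
    congr (nabla _ _ _); apply/funext => v; exact: deriveZdir.
  by rewrite nablaZ ?size_nseq ?nabla_nseqZ ?mulrA//; exact: Dg.
have B a b : nabla g (h' :: nseq p s') a - nabla g (h' :: nseq p s') b
    <= M * enorm (a - b).
  rewrite -lee_fin; apply: le_trans (lip a b); apply: ereal_sup_ubound.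
  exists (cons_tuple h' (nseq_tuple p s')) => //= i.
  have /= := mem_tnth i (cons_tuple h' (nseq_tuple p s')).
  by rewrite inE => /orP[/eqP->//|/nseqP[->]].
have ab0 : 0 <= enorm h * enorm s ^+ p.
  by rewrite mulr_ge0 ?exprn_ge0 ?enorm_ge0.
have {}E z : nabla g (h :: nseq p s) z =
    enorm h * enorm s ^+ p * nabla g (h' :: nseq p s') z.
  by rewrite -E -Eh -Es.
rewrite !E -mulrBr normrM (ger0_norm ab0) [leRHS]mulrC ler_wpM2l//.
rewrite ler_norml B andbT lerNl opprB.
by rewrite -(enormN (x - y)) opprB B.
Qed.

Lemma derive_ge0_of_right_min (phi : R -> R) (d : R) :
  is_derive (0 : R) (1 : R) phi d -> (forall t, 0 < t -> phi 0 <= phi t) ->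
  0 <= d.
Proof.
move=> [dphi <-] H.
have /cvg_dnbhs_at_right cr : (h^-1 *: (phi (h *: 1 + 0) - phi 0))
   @[h --> (0:R)^'] --> 'D_1 phi 0 := dphi.
rewrite -(cvg_lim _ cr)//; apply: limr_ge; first by apply/cvg_ex; eexists; exact: cr.
near=> t; apply: mulr_ge0; first by rewrite invr_ge0 ltW.
by rewrite subr_ge0 H// addr0 [_ *: 1]mulr1.
Unshelve. all: by end_near. Qed.

(** Two estimates of the Taylor polynomial T of 'D_h g at x are added.  Taylor's
    formula of order p-1 bounds 'D_h g y - T by M / p! |y-x|^p |h|, and minimality
    of the model at y bounds -T by p times that.  The second
    uses minimality only in the direction h and replaces |y - x + t h| by
    |y - x| + t |h|, so that the norm, which is not differentiable at 0,
    need not be differentiated. *)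
Lemma tensor_step_derive_le p M g x y h : (0 < p)%N -> 0 <= M ->
  times_differentiable p g -> lipschitz_nabla p M g ->
  is_tensor_step g p (p%:R * M) x y ->
  - 'D_h g y <= p.+1%:R * M / p`!%:R * enorm (y - x) ^+ p * enorm h.
Proof.
case: p => // p _ M0 tg lip st.
set s := y - x; have yE : y = x + 1 *: s by rewrite scale1r /s addrC subrK.
have [dg Dg] := tg.
pose T := \sum_(r < p.+1) (r`!%:R)^-1 * nabla ('D_h g) (nseq r s) x.
have Tle : `|'D_h g y - T| <= M / p.+1`!%:R * enorm s ^+ p.+1 * enorm h.
  have := @taylor_remainder _ _ p ('D_h g) x s (M * enorm s ^+ p.+1 * enorm h)
    (Dg h) _ 1 ler01.
  rewrite -yE expr1n mulr1.
  have -> : \sum_(r < p.+1) 1 ^+ r / r`!%:R * nabla ('D_h g) (nseq r s) x = T.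
    by apply: eq_bigr => r _; rewrite expr1n mul1r.
  have -> : M * enorm s ^+ p.+1 * enorm h / p.+1`!%:R =
    M / p.+1`!%:R * enorm s ^+ p.+1 * enorm h by ring.
  apply => t t0.
  have := lipschitz_nabla_le (x + t *: s) x h s tg lip.
  rewrite addrAC subrr add0r enormZ (ger0_norm t0).
  move/le_trans; apply; rewrite exprS.
  by rewrite le_eqVlt; apply/orP; left; apply/eqP; ring.
have opt : 0 <= T + p.+1%:R * M / p.+1`!%:R * enorm s ^+ p.+1 * enorm h.
  pose phi (t : R) := \sum_(r < p.+2) (r`!%:R)^-1 * nabla g (nseq r (s + t *: h)) x
    + p.+1%:R * M / p.+2`!%:R * (enorm s + t * enorm h) ^+ p.+2.
  apply: (@derive_ge0_of_right_min phi) => [|t t0].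
    apply: is_deriveD.
      rewrite -[X in is_derive _ _ _ X]add0r.
      have -> : (fun t : R => \sum_(r < p.+2) (r`!%:R)^-1 *
           nabla g (nseq r (s + t *: h)) x)
       = (fun t : R => g x + (\sum_(r < p.+1) (r.+1`!%:R)^-1 *:
           (fun t : R => nabla g (nseq r.+1 (s + t *: h)) x)) t).
        apply/funext => v; rewrite big_ord_recl /= fact0 invr1 mul1r.
        by rewrite fct_sumE.
      apply: is_deriveD; apply: is_derive_sum => r.
      have tr : times_differentiable r.+1 g.
        exact: times_differentiable_le tg.
      have := is_deriveZ (r.+1`!%:R)^-1 (is_derive_nabla_diag s h x tr) => H.
      apply: (is_derive_eq H); rewrite /GRing.scale/= mulrA; congr (_ * _).
      rewrite factS natrM invfM mulrAC mulVf ?mul1r// pnatr_eq0.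
    apply: (is_derive_eq (is_derive_affineX _ _ _ _)).
    rewrite [p.+2`!]factS natrM; field.
    by rewrite -natrD !pnatr_eq0 -lt0n fact_gt0.
  have -> : phi 0 = taylor_model g p.+1 (p.+1%:R * M) x y.
    by rewrite /phi mul0r scale0r !addr0.
  apply: (le_trans (st (y + t *: h))).
  rewrite /taylor_model /phi addrAC -/s lerD2l ler_wpM2l//.
    by rewrite !mulr_ge0 ?invr_ge0 ?ler0n.
  rewrite lerXn2r ?nnegrE ?enorm_ge0 ?addr_ge0 ?mulr_ge0 ?enorm_ge0 ?(ltW t0)//.
  by apply: (le_trans (enormD _ _)); rewrite enormZ gtr0_norm.
move: Tle; rewrite ler_norml => /andP[Tle _].
rewrite -[p.+2%:R]nat1r !mulrDl mul1r.
by move: Tle opt; set a := _ * _ * enorm h; set b := _ * _ * enorm h; lra.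
Qed.

Lemma tensor_step_norm_derive_le p M g x y h : (0 < p)%N -> 0 <= M ->
  times_differentiable p g -> lipschitz_nabla p M g ->
  is_tensor_step g p (p%:R * M) x y ->
  `|'D_h g y| <= p.+1%:R * M / p`!%:R * enorm (y - x) ^+ p * enorm h.
Proof.
move=> p0 M0 tg lip st; have B := tensor_step_derive_le _ p0 M0 tg lip st.
have dg : differentiable g y.
  exact: times_differentiable_differentiable tg.
rewrite ler_norml lerNl B /= -[leLHS]opprK -(deriveNdir _ dg) -(enormN h).
exact: B.
Qed.

(** Both the squared distance and the inner product with a vector are quadratic
    along lines, so one coefficient comparison gives their derivatives. *)
Lemma derive_quadratic f x k (a b c : R) : differentiable f x ->
  (forall t, f (x + t *: k) = a + b * t ^+ 1 + c * t ^+ 2) -> 'D_k f x = b.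
Proof.
move=> df E; have x0 : x = x + 0 *: k by rewrite scale0r addr0.
have dx : differentiable f (x + 0 *: k) by rewrite -x0.
have := is_derive_line dx; rewrite -x0.
have -> : (fun t => f (x + t *: k)) =
   (fun t : R => (cst a t + b * t ^+ 1) + c * t ^+ 2).
  by apply/funext => t; rewrite E.
have := is_deriveD (is_deriveD (is_derive_cst a (0 : R) (1 : R))
   (is_derive_monomial b 1 0)) (is_derive_monomial c 2 0).
move=> [_ E1] [_ E2]; apply: etrans (esym E2) _; apply: etrans E1 _.
by rewrite expr0 expr1 !mulr1 !mulr0 add0r addr0.
Qed.

Lemma differentiable_affine z h x : differentiable (fun x => dot (x - z) h) x.
Proof.
have -> : (fun x : V => dot (x - z) h) =
    \sum_(i < n) (fun x : V => h ord0 i * (x ord0 i - z ord0 i)).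
  apply/funext => y; rewrite fct_sumE; apply: eq_bigr => i _.
  by rewrite !mxE mulrC.
apply: differentiable_sum => i; apply: differentiableZ.
by apply: differentiableB; [exact: differentiable_coord|exact: differentiable_cst].
Qed.

Lemma differentiable_sqnorm z x : differentiable (fun x => enorm (x - z) ^+ 2) x.
Proof.
have -> : (fun x : V => enorm (x - z) ^+ 2) =
    \sum_(i < n) ((fun x : V => x ord0 i - z ord0 i : R^o) *
                  (fun x : V => x ord0 i - z ord0 i : R^o)).
  apply/funext => y; rewrite fct_sumE enorm_sqr; apply: eq_bigr => i _.
  by rewrite !mxE.
apply: differentiable_sum => i.
have dc : differentiable (fun x : V => x ord0 i - z ord0 i : R^o) x.
  by apply: differentiableB; [exact: differentiable_coord|exact: differentiable_cst].
exact: differentiableM.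
Qed.

Lemma derive_affine z h k x : 'D_k (fun x => dot (x - z) h) x = dot k h.
Proof.
apply: (@derive_quadratic _ _ _ (dot (x - z) h) _ 0).
  exact: differentiable_affine.
by move=> t; rewrite addrAC; move: (x - z) => w; rewrite !dotE; ring.
Qed.

Lemma derive_sqnorm z h x :
  'D_h (fun x => enorm (x - z) ^+ 2) x = 2 * dot (x - z) h.
Proof.
apply: (@derive_quadratic _ _ _ (dot (x - z) (x - z)) _ (dot h h)).
  exact: differentiable_sqnorm.
by move=> t; rewrite addrAC enorm_sqr; move: (x - z) => w; rewrite !dotE (dotC h w); ring.
Qed.

Lemma times_differentiable_cst p c : times_differentiable p (fun _ : V => c).
Proof.
elim: p c => [//|p IH] c; split=> [x|h]; first exact: differentiable_cst.
rewrite [X in times_differentiable _ X](_ : _ = fun _ => 0) //.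
by apply/funext => x; exact: derive_cst.
Qed.

Lemma times_differentiable_sqnorm p z :
  times_differentiable p (fun x : V => enorm (x - z) ^+ 2).
Proof.
case: p => [//|p]; split=> [x|h]; first exact: differentiable_sqnorm.
rewrite [X in times_differentiable _ X](_ : _ =
    fun x => 0 + 2 * dot (x - z) h); last first.
  by apply/funext => x; rewrite add0r derive_sqnorm.
apply: (@times_differentiable_lin _ _ p (fun=> 0)).
  exact: times_differentiable_cst.
case: p => [//|p]; split=> [x|k]; first exact: differentiable_affine.
rewrite [X in times_differentiable _ X](_ : _ = fun _ => dot k h).
  exact: times_differentiable_cst.
by apply/funext => x; rewrite derive_affine.
Qed.

Lemma nabla_cst c hs : exists d, nabla (fun _ : V => c) hs = fun _ => d.
Proof.
elim: hs c => [|h hs IH] c; first by exists c.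
rewrite /nabla /=; rewrite (_ : 'D_h _ = fun _ => 0); first exact: IH.
by apply/funext => x; exact: derive_cst.
Qed.

Lemma nabla_sqnorm z hs : (1 < size hs)%N ->
  exists d, nabla (fun x : V => enorm (x - z) ^+ 2) hs = fun _ => d.
Proof.
case: hs => [|h [|k hs]]// _.
have [d E] := nabla_cst (2 * dot k h) hs; exists d; rewrite -E.
rewrite /nabla /=; congr (foldl _ _ _); apply/funext => x.
have -> : 'D_h (fun x => enorm (x - z) ^+ 2) = fun x => 2 * dot (x - z) h.
  by apply/funext => y; rewrite derive_sqnorm.
rewrite -[LHS]/('D_k (2 *: (fun x => dot (x - z) h)) x) deriveZ.
  by rewrite derive_affine.
exact/diff_derivable/differentiable_affine.
Qed.

Lemma times_differentiable_regularized p f L z : times_differentiable p f ->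
  times_differentiable p (regularized f L z).
Proof.
move=> tf; apply: times_differentiable_lin => //.
exact: times_differentiable_sqnorm.
Qed.

Lemma derive_regularized f L z x h : differentiable f x ->
  'D_h (regularized f L z) x = 'D_h f x + L * dot (x - z) h.
Proof.
move=> df; rewrite derive_linfun//; last exact: differentiable_sqnorm.
by rewrite derive_sqnorm; field.
Qed.

(** Derivatives of order at least 2 of the squared distance are constant, so
    they cancel in differences.  For p = 1 this fails, which is why that case
    needs a separate analysis. *)
Lemma lipschitz_nabla_regularized p M f L z : (1 < p)%N ->
  times_differentiable p f -> lipschitz_nabla p M f ->
  lipschitz_nabla p M (regularized f L z).
Proof.
move=> p1 tf lip x y; apply: le_trans (lip x y).
rewrite le_eqVlt; apply/orP; left; apply/eqP; congr form_norm.
apply/funext => hs.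
rewrite !nabla_lin ?size_tuple//; try exact: times_differentiable_sqnorm.
have [|d ->] := @nabla_sqnorm z hs; first by rewrite size_tuple.
ring.
Qed.

(** The derivative of [regularized f L x] at y in the direction h is the inner
    product of grad f y + L (y - x) with h; taking h to be this vector itself
    turns the bound on derivatives into a bound on its norm. *)
Lemma prox_tensor_step_residual p M f L x y : (1 < p)%N -> 0 <= M -> 0 < L ->
  times_differentiable p f -> lipschitz_nabla p M f ->
  is_tensor_step (regularized f L x) p (p%:R * M) x y ->
  2 * p.+1%:R * M / (p`!%:R * L) * enorm (y - x) ^+ p.-1 <= 1 ->
  enorm (grad f y + L *: (y - x)) <= L / 2 * enorm (y - x).
Proof.
move=> p1 M0 L0 tf lip st small; set v := _ + _.
have df : differentiable f y.
  exact: times_differentiable_differentiable (ltnW p1) tf.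
have := tensor_step_norm_derive_le v (ltnW p1) M0
  (times_differentiable_regularized L x tf)
  (lipschitz_nabla_regularized L x p1 tf lip) st.
rewrite derive_regularized// -grad_dot// -dotZl -dotDl -enorm_sqr.
rewrite ger0_norm ?exprn_ge0 ?enorm_ge0// => B.
have [v0|v0] := eqVneq (enorm v) 0.
  by rewrite v0 mulr_ge0 ?enorm_ge0 ?divr_ge0// ltW.
have vgt0 : 0 < enorm v by rewrite lt_def v0 enorm_ge0.
move: B; rewrite expr2 ler_pM2r// => /le_trans; apply.
rewrite -[p in _ ^+ p]prednK ?(ltnW p1)// exprSr mulrA ler_wpM2r ?enorm_ge0//.
have : L / 2 * (2 * p.+1%:R * M / (p`!%:R * L) * enorm (y - x) ^+ p.-1) <= L / 2.
  by rewrite ler_piMr// divr_ge0// ltW.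
apply: le_trans; rewrite le_eqVlt; apply/orP; left; apply/eqP; field.
by rewrite gt_eqF// pnatr_eq0 -lt0n fact_gt0.
Qed.

(** At its own centre the regularization has value and gradient 0, so the
    first-order model is that of f and its minimizer is a gradient step.  The
    square is completed by comparing y with the claimed minimizer. *)
Lemma prox_gradient_step M f L x y : 0 < M -> times_differentiable 1 f ->
  is_tensor_step (regularized f L x) 1 M x y -> y = x - M^-1 *: grad f x.
Proof.
move=> M0 [df _] st; set g := grad f x.
pose y' := x - M^-1 *: g.
have E w : taylor_model (regularized f L x) 1 M x w =
    f x + dot g (w - x) + M / 2 * dot (w - x) (w - x).
  rewrite /taylor_model big_ord_recl big_ord1 fact0 invr1 /= !mul1r.
  rewrite derive_regularized// subrr -(scale0r 0) dotZl mul0r mulr0 addr0.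
  by rewrite -grad_dot// /regularized subrr enorm0 expr0n mulr0 addr0 enorm_sqr.
have Ey : y' - x = - (M^-1 *: g) by rewrite /y' addrAC subrr add0r.
have := st y'; rewrite !E Ey.
have yE : y = x + (y - x) by rewrite addrC subrK.
move: (y - x) yE => s {1}->; rewrite !dotE => H.
have : dot (M *: s + g) (M *: s + g) <= 0.
  rewrite !dotE (dotC s g).
  have M20 : 0 < 2 * M by rewrite mulr_gt0.
  have := ler_wpM2l (ltW M20) H.
  rewrite [leRHS](_ : _ = 2 * M * f x - dot g g); last by field; rewrite gt_eqF.
  rewrite [leLHS](_ : _ = 2 * M * f x + 2 * M * dot g s + M ^+ 2 * dot s s).
    by lra.
  by field.
move=> H0; have : M *: s + g = 0.
  by apply: dot_eq0; apply/eqP; rewrite eq_le H0 dot_ge0.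
move/eqP; rewrite addr_eq0 => /eqP Es.
by rewrite -scalerN -Es scalerA mulVf ?gt_eqF// scale1r.
Qed.

End TensorStep.

(** * Growth of a sequence under a weighted budget *)

Section Growth.
Context {R : realType}.
Implicit Types (a th x y : R).

Lemma weighted_amgm a x y : 0 < a < 1 -> 0 <= x -> 0 <= y ->
  x `^ a * y `^ (1 - a) <= a * x + (1 - a) * y.
Proof.
move=> /andP[a0 a1] x0 y0; have b0 : 0 < 1 - a by rewrite subr_gt0.
have := @conjugate_powR R (x `^ a) (y `^ (1 - a)) a^-1 (1 - a)^-1
  (powR_ge0 _ _) (powR_ge0 _ _).
rewrite !invr_gt0 => /(_ a0 b0); rewrite !invrK subrKC => /(_ erefl).
by rewrite -!powRrM !mulfV ?gt_eqF// !powRr1// (mulrC a) (mulrC (1 - a)).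
Qed.

(** Hoelder's inequality for a sum of N ones, each of which is dominated by a
    geometric mean: after normalizing by the totals, every term is at most an
    arithmetic mean, and these means sum to at most 1. *)
Lemma holder_count a (c : R) (N : nat) (X Y : nat -> R) (SX SY : R) :
  0 < a < 1 -> 0 <= c -> 0 < SX -> 0 < SY ->
  (forall k, (k < N)%N -> 0 <= X k) -> (forall k, (k < N)%N -> 0 <= Y k) ->
  (forall k, (k < N)%N -> 1 <= c * (X k `^ a * Y k `^ (1 - a))) ->
  \sum_(k < N) X k <= SX -> \sum_(k < N) Y k <= SY ->
  N%:R <= c * (SX `^ a * SY `^ (1 - a)).
Proof.
move=> a01 c0 SX0 SY0 X0 Y0 H HX HY.
have /andP[a0 a1] := a01.
set Z := c * _.
have Z0 : 0 <= Z by rewrite mulr_ge0// mulr_ge0 ?powR_ge0.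
have -> : N%:R = \sum_(k < N) (1 : R) by rewrite sumr_const card_ord.
apply: (@le_trans _ _ (\sum_(k < N) Z * (a * (X k / SX) + (1 - a) * (Y k / SY)))).
  apply: ler_sum => k _; apply: (le_trans (H k (ltn_ord k))).
  have xk := X0 k (ltn_ord k); have yk := Y0 k (ltn_ord k).
  have -> : c * (X k `^ a * Y k `^ (1 - a)) =
      Z * ((X k / SX) `^ a * (Y k / SY) `^ (1 - a)).
    have {1}-> : X k = SX * (X k / SX) by rewrite mulrC divfK// gt_eqF.
    have {1}-> : Y k = SY * (Y k / SY) by rewrite mulrC divfK// gt_eqF.
    rewrite (powRM _ (ltW SX0) (divr_ge0 xk (ltW SX0))).
    rewrite (powRM _ (ltW SY0) (divr_ge0 yk (ltW SY0))) /Z.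
    ring.
  rewrite ler_wpM2l// weighted_amgm ?divr_ge0// ltW//.
rewrite -mulr_sumr big_split /= -!mulr_sumr -!mulr_suml.
rewrite ler_piMr//.
have hx : (\sum_(k < N) X k) / SX <= 1 by rewrite ler_pdivrMr// mul1r.
have hy : (\sum_(k < N) Y k) / SY <= 1 by rewrite ler_pdivrMr// mul1r.
nra.
Qed.

(** The discrete form of the integral of S^(th-1) dS, with the weights taken at
    the right endpoints; concavity of the power th gives the inequality. *)
Lemma sum_powR_le th (w : nat -> R) N : 0 < th < 1 ->
  (forall k, (k < N)%N -> 0 < w k) ->
  \sum_(k < N) (\sum_(j < k.+1) w j) `^ (th - 1) * w k
    <= (\sum_(j < N) w j) `^ th / th.
Proof.
move=> th01; have /andP[th0 th1] := th01.
elim: N => [|N IH] w0.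
  by rewrite !big_ord0 powR0 ?gt_eqF// mul0r.
have {}IH := IH (fun k kN => w0 k (ltnW kN)).
have E : \sum_(j < N.+1) w j = \sum_(j < N) w j + w N by rewrite big_ord_recr.
rewrite big_ord_recr /= E; apply: (le_trans (lerD IH (lexx _))).
have S0 : 0 <= \sum_(j < N) w j.
  by apply: sumr_ge0 => j _; apply/ltW/w0; exact: (ltnW (ltn_ord j)).
have wN := w0 N (ltnSn N).
move: (\sum_(j < N) w j) S0 (w N) wN => S S0 v v0.
have Sv : 0 < S + v by rewrite ltr_wpDl.
rewrite -[(S + v) `^ (th - 1) * v](mulfK (lt0r_neq0 th0)) -mulrDl.
rewrite ler_pM2r ?invr_gt0//.
have := weighted_amgm th01 S0 (ltW Sv).
move/(ler_wpM2r (powR_ge0 (S + v) (th - 1))).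
rewrite -mulrA -powRD; last by rewrite (gt_eqF Sv) implybT.
rewrite addrA subrK subrr powRr0 mulr1.
have -> : (th * S + (1 - th) * (S + v)) * (S + v) `^ (th - 1) =
  (S + v) * (S + v) `^ (th - 1) - (S + v) `^ (th - 1) * v * th by ring.
by rewrite mulr_powRB1 ?(ltW Sv)// lerBrDr.
Qed.

(** The sequence S_k is, up to a factor 2, a lower bound for the square root of
    A_k, so the hypothesis is the energy budget.  Hoelder's inequality is applied
    to the budget terms X_k = S_{k+1}^2 L_k r_k^2 and to
    Y_k = S_{k+1}^(th-1) L_k^(-1/2), whose sum is at most S_N^th / th.  The
    exponents a = (p-1)/(3p+1) and th = 2/(p+1) are those for which S_{k+1}
    cancels from X_k^a Y_k^(1-a), and the latter becomes a power of
    r_k^(p-1) / L_k, which is bounded below. *)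
Lemma growth_rate (p N : nat) (kap B : R) (L r : nat -> R) :
  (1 < p)%N -> 0 < kap -> 0 < B ->
  (forall k, (k < N)%N -> [/\ 0 < L k, 0 <= r k & L k <= kap * r k ^+ p.-1]) ->
  let S K := \sum_(k < K) (Num.sqrt (L k))^-1 in
  \sum_(k < N) S k.+1 ^+ 2 * L k * r k ^+ 2 <= B ->
  N%:R `^ ((3 * p + 1)%:R / 2) <=
    kap * B `^ (p.-1%:R / 2) * (p.+1%:R / 2) ^+ p.+1 * S N ^+ 2.
Proof.
move=> p1 kap0 B0 H S HB.
case: N H HB => [|N] H HB.
  rewrite powR0; first by rewrite /S big_ord0 expr0n mulr0.
  by rewrite mulf_neq0 ?invr_eq0// pnatr_eq0.
have w0 k : (k < N.+1)%N -> 0 < (Num.sqrt (L k))^-1.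
  by move=> /H[L0 _ _]; rewrite invr_gt0 sqrtr_gt0.
have S0 k : (k <= N)%N -> 0 < S k.+1.
  move=> kN; rewrite /S big_ord_recr /= ltr_wpDl ?w0//.
  by apply: sumr_ge0 => j _; rewrite invr_ge0 sqrtr_ge0.
have r0 k : (k < N.+1)%N -> 0 < r k.
  move=> /H[Lk rk le]; rewrite lt_def rk andbT; apply/eqP => rk0; move: le.
  have pN0 : (p.-1 == 0)%N = false by case: (p) p1 => [|[]].
  by rewrite rk0 expr0n pN0 mulr0 leNgt Lk.
pose P : R := p%:R.
have P1 : 1 < P by rewrite ltr1n.
have Pp1 : p.-1%:R = P - 1 :> R by rewrite -subn1 natrB// ltnW.
have PS : p.+1%:R = P + 1 :> R by rewrite -addn1 natrD.
have P3 : (3 * p + 1)%:R = 3 * P + 1 :> R by rewrite natrD natrM.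
rewrite P3 PS Pp1.
pose a : R := (P - 1) / (3 * P + 1).
pose th : R := 2 / (P + 1).
have P30 : 0 < 3 * P + 1 by lra.
have P10 : 0 < P + 1 by lra.
have a01 : 0 < a < 1.
  apply/andP; split; first by rewrite divr_gt0// subr_gt0.
  by rewrite ltr_pdivrMr//; lra.
have th01 : 0 < th < 1.
  apply/andP; split; first by rewrite divr_gt0.
  by rewrite ltr_pdivrMr//; lra.
have /andP[th0 th1] := th01.
have SN0 := S0 N (leqnn N).
have SY0 : 0 < S N.+1 `^ th / th by rewrite divr_gt0// powR_gt0.
have main : N.+1%:R <= kap `^ (2 / (3 * P + 1)) *
    (B `^ a * (S N.+1 `^ th / th) `^ (1 - a)).
  apply: (@holder_count a _ N.+1 (fun k => S k.+1 ^+ 2 * L k * r k ^+ 2)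
    (fun k => S k.+1 `^ (th - 1) * (Num.sqrt (L k))^-1)) => //.
- exact: powR_ge0.
- move=> k kN; have [Lk rk _] := H k kN.
  by rewrite mulr_ge0 ?sqr_ge0// mulr_ge0 ?sqr_ge0// ltW.
- by move=> k kN /=; rewrite mulr_ge0 ?powR_ge0 ?invr_ge0 ?sqrtr_ge0.
- move=> k kN; have [Lk _ le] := H k kN; have rk := r0 k kN; have Sk := S0 k kN.
  have s0 : 0 < Num.sqrt (L k) by rewrite sqrtr_gt0.
  have sV0 := w0 k kN.
  have SL0 : 0 < S k.+1 ^+ 2 * L k by rewrite mulr_gt0// exprn_gt0.
  have X0 : 0 < S k.+1 ^+ 2 * L k * r k ^+ 2 by rewrite mulr_gt0// exprn_gt0.
  have Y0 : 0 < S k.+1 `^ (th - 1) * (Num.sqrt (L k))^-1.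
    by rewrite mulr_gt0// powR_gt0.
  set Z := _ * _.
  have Z0 : 0 < Z.
    by rewrite !mulr_gt0// powR_gt0// ?mulr_gt0 ?exprn_gt0 ?powR_gt0// ?w0.
  rewrite -[leRHS](lnK Z0) -expR0 ler_expR /Z.
  rewrite !(lnM, ln_powR, lnXn, lnV) ?posrE ?mulr_gt0 ?powR_gt0 ?exprn_gt0 ?invr_gt0//.
  rewrite -(powR12_sqrt (ltW Lk)) ln_powR.
  have lnL : ln (L k) <= ln kap + (P - 1) * ln (r k).
    rewrite -Pp1 mulr_natl -lnXn// -lnM ?posrE ?exprn_gt0//.
    by rewrite ler_ln ?posrE// mulr_gt0// exprn_gt0.
  rewrite [leRHS](_ : _ = 2 / (3 * P + 1) * (ln kap + (P - 1) * ln (r k) - ln (L k))).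
    by rewrite mulr_ge0 ?subr_ge0// divr_ge0// ltW.
  by rewrite /a /th mulr2n; field; rewrite !gt_eqF.
- exact: (@sum_powR_le th (fun k => (Num.sqrt (L k))^-1) N.+1 th01 w0).
have e0 : 0 <= (3 * P + 1) / 2 by lra.
have := ge0_ler_powR e0 _ _ main.
rewrite !nnegrE ler0n !mulr_ge0 ?powR_ge0// => /(_ isT isT).
move/le_trans; apply; rewrite le_eqVlt; apply/orP; left; apply/eqP.
rewrite powRM ?mulr_ge0 ?powR_ge0// powRM ?powR_ge0//.
rewrite -!powRrM.
have -> : 2 / (3 * P + 1) * ((3 * P + 1) / 2) = 1 by field; rewrite gt_eqF.
have -> : a * ((3 * P + 1) / 2) = (P - 1) / 2 by rewrite /a; field; rewrite gt_eqF.
have -> : (1 - a) * ((3 * P + 1) / 2) = P + 1 by rewrite /a; field; rewrite gt_eqF.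
rewrite powRM ?powR_ge0 ?invr_ge0 ?(ltW th0)// -powRrM.
have -> : th * (P + 1) = 2%:R by rewrite /th; field; rewrite gt_eqF.
rewrite powR_mulrn ?(ltW SN0)// -[X in th^-1 `^ X]PS powR_mulrn ?invr_ge0 ?(ltW th0)//.
rewrite powRr1 ?(ltW kap0)// /th invf_div. ring.
Qed.

Lemma pow4_le_pow2 (m : nat) : (m.+2 ^ 4 <= 2 ^ (3 * m + 4))%N.
Proof.
elim: m => [//|m IH].
have -> : (3 * m.+1 + 4 = 3 + (3 * m + 4))%N by lia.
rewrite expnD; apply: leq_trans (leq_mul (leqnn _) IH).
by rewrite !expnS !expn0; nia.
Qed.

(** Taking logarithms, the claim follows from m^4 <= 2^(3m-2) for m = p+1. *)
Lemma rate_constant_le (p : nat) : (0 < p)%N ->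
  8 `^ (p.-1%:R / 2) * 8 * (p.+1%:R / 2) ^+ p.+1
    <= 2 `^ ((3 * p.+1%:R ^+ 2 + 4) / 4) :> R.
Proof.
case: p => // p _ /=.
pose m : R := p.+2%:R.
have m0 : 0 < m by rewrite ltr0n.
have pE : p%:R = m - 2 :> R by rewrite /m -[p.+2]addn2 natrD addrK.
have l2 : 0 <= ln 2 :> R by rewrite ln_ge0// ler1n.
have lnm : 4 * ln m <= (3 * m - 2) * ln 2.
  have : (p.+2 ^ 4)%:R <= (2 ^ (3 * p + 4))%:R :> R by rewrite ler_nat pow4_le_pow2.
  rewrite !natrX -ler_ln ?posrE ?exprn_gt0// !lnXn//.
  rewrite -(mulr_natl (ln _) 4) -(mulr_natl (ln _) (3 * p + 4)).
  by rewrite natrD natrM pE -/m; lra.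
have ln8 : ln 8 = 3 * ln 2 :> R.
  have -> : 8 = 2 ^+ 3 :> R by rewrite -natrX.
  by rewrite lnXn// mulr_natl.
have e0 : 0 < 8 `^ (p%:R / 2) :> R by exact: powR_gt0.
have e80 : 0 < 8 `^ (p%:R / 2) * 8 :> R by exact: mulr_gt0.
have h0 : 0 < p.+2%:R / 2 :> R by exact: divr_gt0.
have hX0 : 0 < (p.+2%:R / 2) ^+ p.+2 :> R by exact: exprn_gt0.
have l0 := mulr_gt0 e80 hX0.
rewrite -ler_ln ?posrE ?powR_gt0//.
rewrite lnM ?posrE// lnM ?posrE// !ln_powR lnXn//.
rewrite ln_div ?posrE// -(mulr_natl (_ - _) p.+2) -/m ln8.
rewrite [leRHS](_ : _ = 3 / 4 * m ^+ 2 * ln 2 + ln 2); last by field.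
have := ler_wpM2l (ltW m0) lnm.
lra.
Qed.

End Growth.

(** * Energy estimate and rate of the optimal tensor method *)

Section OptimalTensorMethod.
Context {R : realType} {n : nat}.
Local Notation V := 'rV[R]_n.
Implicit Types (f : V -> R) (x y u v xs : V) (a A L M e : R).

Lemma uniformly_convex_above_tangent q sigma f x y : 0 < q -> 0 < sigma ->
  uniformly_convex q sigma f -> f x + dot (grad f x) (y - x) <= f y.
Proof.
move=> q0 s0 ucv; apply: le_trans (ucv x y); rewrite lerDl.
by rewrite mulr_ge0 ?powR_ge0// divr_ge0// ltW.
Qed.

(** The descent lemma, as Taylor's formula of order 1. *)
Lemma smooth_upper_bound M f x s : times_differentiable 1 f ->
  lipschitz_nabla 1 M f ->
  f (x + s) <= f x + dot (grad f x) s + M / 2 * dot s s.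
Proof.
move=> tf lip; have [df _] := tf.
have := @taylor_remainder _ _ 1 f x s (M * enorm s ^+ 2) tf _ 1 ler01.
rewrite scale1r.
have -> : \sum_(r < 2) 1 ^+ r / r`!%:R * nabla f (nseq r s) x =
    f x + dot (grad f x) s.
  by rewrite big_ord_recl big_ord1 /= !expr1n !divr1 !mul1r -grad_dot.
rewrite expr1n mulr1 enorm_sqr => H.
have : `|f (x + s) - (f x + dot (grad f x) s)| <= M * dot s s / 2.
  apply: H => t t0.
  have := @lipschitz_nabla_le _ _ 0 M f (x + t *: s) x s s tf lip.
  rewrite expr0 mulr1 addrAC subrr add0r enormZ (ger0_norm t0) -enorm_sqr.
  move/le_trans; apply.
  by rewrite le_eqVlt; apply/orP; left; apply/eqP; ring.
by rewrite ler_norml => /andP[_]; lra.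
Qed.

(** The lower tangent bound at v and the quadratic upper bound at w are compared
    at the point w - d / M, where d is the difference of the gradients; adding
    the result to the one with v and w exchanged gives the claim. *)
Lemma gradient_cocoercive M f x y : 0 < M ->
  times_differentiable 1 f -> lipschitz_nabla 1 M f ->
  (forall x y, f x + dot (grad f x) (y - x) <= f y) ->
  dot (grad f y - grad f x) (grad f y - grad f x) / M
    <= dot (grad f y - grad f x) (y - x).
Proof.
move=> M0 tf lip cvx.
have half v w : f v + dot (grad f v) (w - v)
    + dot (grad f w - grad f v) (grad f w - grad f v) / (2 * M) <= f w.
  set d := grad f w - grad f v.
  have E : dot (grad f w) d - dot (grad f v) d = dot d d by rewrite -dotBl.
  clearbody d.
  have := smooth_upper_bound w (- (M^-1 *: d)) tf lip.
  have := cvx v (w - M^-1 *: d).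
  have -> : w - M^-1 *: d - v = (w - v) - M^-1 *: d by rewrite addrAC.
  rewrite !dotBr !dotNr !dotNl !dotZr !dotZl => H1 H2.
  have := le_trans H1 H2; rewrite opprK.
  have -> : M / 2 * (M^-1 * (M^-1 * dot d d)) = M^-1 * dot d d / 2.
    by field; rewrite gt_eqF.
  have -> : dot d d / (2 * M) = M^-1 * dot d d / 2 by field; rewrite gt_eqF.
  have := congr1 ( *%R M^-1) E; rewrite mulrBr; lra.
have := half x y; have := half y x.
set g := grad f x; set g' := grad f y.
have -> : dot (g - g') (g - g') = dot (g' - g) (g' - g).
  by rewrite -opprB dotNl dotNr opprK.
have -> : dot g' (x - y) = - dot g' (y - x) by rewrite -opprB dotNr.
have -> : dot (g' - g) (y - x) = dot g' (y - x) - dot g (y - x).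
  by rewrite dotBl.
move: (dot (g' - g) (g' - g)) => d2.
have -> : d2 / M = 2 * (d2 / (2 * M)) by field; rewrite gt_eqF.
lra.
Qed.

(** The weight a is the positive root of L a^2 = A + a, the relation used by
    the energy estimate. *)
Lemma step_weight a A L : 0 <= A -> 0 < L ->
  a = (L^-1 + Num.sqrt (L^-1 ^+ 2 + 4 * A / L)) / 2 ->
  0 < a /\ L * a ^+ 2 = A + a.
Proof.
move=> A0 L0; set s := Num.sqrt _ => ->.
have l0 : 0 < L^-1 by rewrite invr_gt0.
have s0 : 0 <= s by exact: sqrtr_ge0.
split; first by rewrite divr_gt0// ltr_wpDr.
have s2 : s ^+ 2 = L^-1 ^+ 2 + 4 * A / L.
  by rewrite sqr_sqrtr// addr_ge0 ?sqr_ge0// divr_ge0 ?(ltW L0)// mulr_ge0.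
have -> : L * ((L^-1 + s) / 2) ^+ 2 = L * (L^-1 ^+ 2 + 2 * L^-1 * s + s ^+ 2) / 4.
  by field; rewrite gt_eqF.
by rewrite s2; field; rewrite gt_eqF.
Qed.

(** The tangent at y' bounds f from below at the old iterate y and at the
    minimizer; averaging these bounds with weights A and a makes the inner
    product with x appear, since x is the corresponding average of y and u.  The
    term a <g, u - xs> cancels against the one from the expansion of
    |u' - xs|^2, and a^2 = (A + a) / L makes the rest a multiple of the assumed
    progress e. *)
Lemma energy_step f xs a A L e x y u y' u' :
  (forall x y, f x + dot (grad f x) (y - x) <= f y) ->
  0 <= A -> 0 < L -> 0 < a -> L * a ^+ 2 = A + a ->
  x = (A / (A + a)) *: y + (a / (A + a)) *: u ->
  u' = u - a *: grad f y' ->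
  2 * dot (grad f y') (y' - x) + dot (grad f y') (grad f y') / L <= - e ->
  (A + a) * (f y' - f xs) + enorm (u' - xs) ^+ 2 / 2 + (A + a) * e / 2
    <= A * (f y - f xs) + enorm (u - xs) ^+ 2 / 2.
Proof.
move=> cvx A0 L0 a0 La xE -> step.
have Ap0 : 0 < A + a by rewrite ltr_wpDl.
have := cvx y' y; have := cvx y' xs; move: step.
set g := grad f y'.
have xE' : (A + a) * dot g x = A * dot g y + a * dot g u.
  rewrite xE dotDr !dotZr; field; by rewrite gt_eqF.
have a2 : a ^+ 2 = (A + a) / L.
  by rewrite -La; field; rewrite gt_eqF.
have -> : enorm (u - a *: g - xs) ^+ 2 = enorm (u - xs) ^+ 2
    - 2 * (a * (dot g u - dot g xs)) + (A + a) * (dot g g / L).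
  rewrite !enorm_sqr !dotE (dotC u g) (dotC xs g) (dotC xs u).
  have -> : (A + a) * (dot g g / L) = a ^+ 2 * dot g g.
    by rewrite a2; field; rewrite gt_eqF.
  ring.
rewrite !dotBr => step c1 c2.
have := ler_wpM2l A0 c2; have := ler_wpM2l (ltW a0) c1.
have := ler_wpM2l (ltW Ap0) step.
move: xE'; set gx := dot g x; set gu := dot g u; set gg := _ / L.
set gy := dot g y; set gs := dot g xs; set gy' := dot g y'.
move: (f y') (f y) (f xs) gx gu gg gy gs gy' => fy' fy fs gx gu gg gy gs gy'.
lra.
Qed.

(** Since a = sqrt ((A + a) / L) is the increment of A, the square root of A
    grows by at least half of the inverse square root of L. *)
Lemma sqrt_weight_growth A a L : 0 <= A -> 0 < L -> 0 < a ->
  L * a ^+ 2 = A + a ->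
  (Num.sqrt L)^-1 + 2 * Num.sqrt A <= 2 * Num.sqrt (A + a).
Proof.
move=> A0 L0 a0 La; have Ap0 : 0 < A + a by rewrite ltr_wpDl.
have l0 : 0 < Num.sqrt L by rewrite sqrtr_gt0.
have q0 : 0 < Num.sqrt (A + a) by rewrite sqrtr_gt0.
have b0 : 0 <= Num.sqrt A := sqrtr_ge0 A.
have bq : Num.sqrt A <= Num.sqrt (A + a) by rewrite ler_wsqrtr// lerDl ltW.
have aE : a = Num.sqrt (A + a) ^+ 2 - Num.sqrt A ^+ 2.
  by rewrite !sqr_sqrtr ?(ltW Ap0)//; ring.
have La' : Num.sqrt L * a = Num.sqrt (A + a).
  apply/eqP; rewrite -(@eqrXn2 _ 2) ?mulr_ge0 ?(ltW l0) ?(ltW a0) ?(ltW q0)//.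
  by rewrite exprMn !sqr_sqrtr ?(ltW L0) ?(ltW Ap0)// La.
move: La'; rewrite {1}aE.
move: (Num.sqrt L) (Num.sqrt A) (Num.sqrt (A + a)) l0 q0 b0 bq => l b q l0 q0 b0 bq E.
rewrite -lerBrDr -mulrBr -(ler_pM2l l0) mulfV ?gt_eqF//.
rewrite -(ler_pM2l q0) mulr1 -{1}E.
have : l * (q - b) * b <= l * (q - b) * q.
  by rewrite ler_wpM2l// mulr_ge0 ?subr_ge0// ltW.
lra.
Qed.

Section Run.
Context (f : V -> R) (p : nat) (M : R) (N : nat) (y0 xs : V).
Context (L a A : nat -> R) (x y u : nat -> V).
Context (run : optimal_tensor_run f p M N y0 L a A x y u).

Lemma run_weights k : (k <= N)%N ->
  0 <= A k /\ \sum_(j < k) (Num.sqrt (L j))^-1 <= 2 * Num.sqrt (A k).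
Proof.
have [_ _ A0 step] := run.
elim: k => [_|k IH kN]; first by rewrite A0 big_ord0 sqrtr0 mulr0.
have [Ak Sk] := IH (ltnW kN).
have [[Lk _] [aE AE] _ _ _] := step k kN.
have [ak La] := step_weight Ak Lk aE.
rewrite AE big_ord_recr /= addr_ge0 ?(ltW ak)//; split=> //.
apply: le_trans (sqrt_weight_growth Ak Lk ak La).
by rewrite addrC lerD2l.
Qed.

Lemma run_energy (e : nat -> R) :
  (forall x y, f x + dot (grad f x) (y - x) <= f y) ->
  (forall k, (k < N)%N -> let g := grad f (y k.+1) in
     2 * dot g (y k.+1 - x k) + dot g g / L k <= - e k) ->
  A N * (f (y N) - f xs) + (\sum_(k < N) A k.+1 * e k) / 2
    <= enorm (y0 - xs) ^+ 2 / 2.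
Proof.
move=> cvx he; have [yE uE A0 step] := run.
suff H k : (k <= N)%N -> A k * (f (y k) - f xs) + enorm (u k - xs) ^+ 2 / 2
    + (\sum_(j < k) A j.+1 * e j) / 2 <= enorm (y0 - xs) ^+ 2 / 2.
  apply: le_trans (H N (leqnn N)); rewrite lerD2r lerDl.
  by rewrite divr_ge0// sqr_ge0.
elim: k => [_|k IH kN]; first by rewrite A0 uE big_ord0 !mul0r add0r addr0.
have {}IH := IH (ltnW kN); have [Ak _] := run_weights (ltnW kN).
have [[Lk _] [aE AE] xE _ u'E] := step k kN.
have [ak La] := step_weight Ak Lk aE.
rewrite AE in xE.
have := energy_step xs cvx Ak Lk ak La xE u'E (he k kN).
rewrite big_ord_recr /= AE => En; apply: le_trans IH.
by lra.
Qed.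

End Run.

(** Squaring the residual bound; the factor 3/4 is 1 - (1/2)^2. *)
Lemma residual_progress L (g d : V) : 0 < L ->
  enorm (g + L *: d) <= L / 2 * enorm d ->
  2 * dot g d + dot g g / L <= - (3 / 4 * L * enorm d ^+ 2).
Proof.
move=> L0 H.
have : enorm (g + L *: d) ^+ 2 <= (L / 2 * enorm d) ^+ 2.
  by rewrite lerXn2r ?nnegrE ?mulr_ge0 ?enorm_ge0// ?divr_ge0// ltW.
rewrite exprMn !enorm_sqr !dotE (dotC d g) -(ler_pM2l L0) => H2.
rewrite -(ler_pM2l L0).
have -> : L * (2 * dot g d + dot g g / L) = 2 * L * dot g d + dot g g.
  by field; rewrite gt_eqF.
by rewrite ler_pM2l// in H2; lra.
Qed.

(** With g and g0 the gradients at y and x, y - x = - g0 / M and cocoercivity says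
    that <g, g0> is at least |g|^2, which absorbs |g|^2 / L because L
    is large compared with M. *)
Lemma gradient_progress M L f x y : 0 < M -> 4 * M <= L ->
  times_differentiable 1 f -> lipschitz_nabla 1 M f ->
  (forall x y, f x + dot (grad f x) (y - x) <= f y) ->
  y = x - M^-1 *: grad f x ->
  2 * dot (grad f y) (y - x) + dot (grad f y) (grad f y) / L <= 0.
Proof.
move=> M0 ML tf lip cvx yE.
have := gradient_cocoercive x y M0 tf lip cvx.
have -> : y - x = - (M^-1 *: grad f x) by rewrite yE addrAC subrr add0r.
move: (grad f y) (grad f x) => g g0; rewrite !dotE (dotC g0 g) => H.
have H2 : dot g g <= dot g g0.
  rewrite -(ler_pM2r M0) in H; move: H; rewrite divfK ?gt_eqF//.
  rewrite [leRHS](_ : _ = dot g0 g0 - dot g g0); last by field; rewrite gt_eqF.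
  lra.
have gL : dot g g / L <= dot g g / M.
  rewrite ler_wpM2l ?dot_ge0// lef_pV2 ?posrE//; lra.
have gM : dot g g / M <= M^-1 * dot g g0.
  by rewrite mulrC ler_wpM2l// invr_ge0 ltW.
have gg0 : 0 <= M^-1 * dot g g0.
  by apply: le_trans gM; rewrite divr_ge0 ?dot_ge0// ltW.
lra.
Qed.

(** The energy estimate bounds S_N^2 times the final gap, S_N being the sum of
    the inverse square roots of the L_k, and the growth lemma bounds S_N from
    below; multiplying the two eliminates S_N. *)
Lemma optimal_tensor_rate f p M N y0 yN xs : (0 < p)%N -> (0 < N)%N ->
  times_differentiable p f -> 0 < M -> lipschitz_nabla p M f ->
  (forall x y, f x + dot (grad f x) (y - x) <= f y) ->
  (forall x, f xs <= f x) ->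
  optimal_tensor_output f p M N y0 yN ->
  (f yN - f xs) * N%:R `^ ((3 * p + 1)%:R / 2)
    <= rate_const p * M * enorm (y0 - xs) ^+ p.+1.
Proof.
move=> p0 N0 tf M0 lip cvx min [L [a [A [x [y [u [run ->]]]]]]].
set R0 := enorm (y0 - xs); set G := f (y N) - f xs.
have G0 : 0 <= G by rewrite subr_ge0.
have [_ _ _ step] := run.
have wts := run_weights run.
pose S K := \sum_(k < K) (Num.sqrt (L k))^-1.
have S0 K : 0 <= S K by apply: sumr_ge0 => j _; rewrite invr_ge0 sqrtr_ge0.
have SA K : (K <= N)%N -> S K ^+ 2 <= 4 * A K.
  move=> /wts[AK SK]; apply: (@le_trans _ _ ((2 * Num.sqrt (A K)) ^+ 2)).
    by rewrite lerXn2r ?nnegrE// mulr_ge0// sqrtr_ge0.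
  by rewrite exprMn sqr_sqrtr// -natrX.
have fac0 : 0 < p`!%:R :> R by rewrite ltr0n fact_gt0.
pose kap : R := 4 * p.+1%:R * M / p`!%:R.
have kap0 : 0 < kap by rewrite divr_gt0// !mulr_gt0.
have Lkap k : (k < N)%N -> L k <= kap * enorm (y k.+1 - x k) ^+ p.-1.
  move=> /step[[Lk /andP[low _]] _ _ _ _].
  have := ler_wpM2l (ltW Lk) low.
  rewrite [leRHS](_ : _ = kap * enorm (y k.+1 - x k) ^+ p.-1 / 2); first by lra.
  by rewrite /kap; field; rewrite !gt_eqF.
have rate (e : nat -> R) : (forall k, (k < N)%N -> 0 <= e k) ->
    (forall k, (k < N)%N -> let g := grad f (y k.+1) in
     2 * dot g (y k.+1 - x k) + dot g g / L k <= - e k) ->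
    S N ^+ 2 * G <= 2 * R0 ^+ 2 /\
    \sum_(k < N) S k.+1 ^+ 2 * e k <= 4 * R0 ^+ 2.
  move=> e0 he; have := run_energy xs run cvx he.
  have AE : \sum_(k < N) S k.+1 ^+ 2 * e k <= 4 * \sum_(k < N) A k.+1 * e k.
    rewrite mulr_sumr; apply: ler_sum => k _; rewrite mulrA.
    by rewrite ler_wpM2r ?e0// SA.
  have sum0 : 0 <= \sum_(k < N) S k.+1 ^+ 2 * e k.
    by apply: sumr_ge0 => k _; rewrite mulr_ge0 ?sqr_ge0 ?e0.
  have SG := ler_wpM2r G0 (SA N (leqnn N)).
  have AG : 0 <= A N * G by rewrite mulr_ge0//; have [] := wts N (leqnn N).
  rewrite -/R0 -/G => En.
  by split; lra.
case: (ltnP 1 p) => p1; last first.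
  have {p0 p1} pE : p = 1%N by apply/eqP; rewrite eqn_leq p1.
  subst p.
  (* No decrease of the energy beyond monotonicity is required here, hence e = 0. *)
  have [||SG _] := rate (fun=> 0); first by [].
    move=> k kN /=; rewrite oppr0; have [[Lk /andP[_ up]] _ _ st _] := step k kN.
    apply: (gradient_progress M0 _ tf lip cvx).
      move: up; rewrite expr0 mulr1 mul1r ler_pdivrMr// mul1r; lra.
    by apply: (prox_gradient_step M0 tf); rewrite mul1r in st; exact: st.
  (* For p = 1 all the L k are at most kap = 8 M, so S N grows linearly. *)
  have NS : N%:R ^+ 2 <= kap * S N ^+ 2.
    have k0 : 0 < Num.sqrt kap by rewrite sqrtr_gt0.
    have NS1 : N%:R <= Num.sqrt kap * S N.
      rewrite -ler_pdivrMl// mulrC -[N in N%:R]card_ord mulr_natl -sumr_const.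
      apply: ler_sum => k _; have := Lkap k (ltn_ord k); rewrite expr0 mulr1 => Lk.
      have [[Lk0 _] _ _ _ _] := step k (ltn_ord k).
      by rewrite lef_pV2 ?posrE ?sqrtr_gt0// ler_wsqrtr.
    rewrite -{1}(sqr_sqrtr (ltW kap0)) -exprMn.
    by rewrite lerXn2r ?nnegrE ?mulr_ge0// ltW.
  have -> : (3 * 1 + 1)%:R / 2 = 2%:R :> R by rewrite natrD natrM; lra.
  rewrite powR_mulrn//.
  have -> : rate_const 1 = 32 :> R.
    rewrite /rate_const.
    have -> : (3 * 2%:R ^+ 2 + 4) / 4 = 4%:R :> R by lra.
    by rewrite powR_mulrn// divr1 -!natrX -natrM.
  have := ler_wpM2l G0 NS; have := ler_wpM2l (ltW kap0) SG.
  have -> : kap = 8 * M by rewrite /kap -[1`!]/1%N; lra.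
  have := mulr_ge0 (ltW M0) (sqr_ge0 R0).
  lra.
have [||SG HB] := rate (fun k => 3 / 4 * L k * enorm (y k.+1 - x k) ^+ 2).
- by move=> k /step[[Lk _] _ _ _ _]; rewrite mulr_ge0 ?sqr_ge0// mulr_ge0// ltW.
- move=> k kN /=; have [[Lk /andP[_ up]] _ _ st _] := step k kN.
  apply: residual_progress => //.
  by apply: (prox_tensor_step_residual p1 (ltW M0) Lk tf lip st up).
(* The growth lemma needs a positive budget; a run that starts at the minimizer
   is treated directly. *)
have [R00|R0pos] := eqVneq R0 0.
  rewrite R00 expr0n /= mulr0.
  have SN : 0 < S N ^+ 2.
    rewrite exprn_gt0// /S; case: (N) N0 step => // N' _ step'.
    rewrite big_ord_recr /= ltr_wpDl ?S0//.
    by have [[Lk _] _ _ _ _] := step' N' (ltnSn N'); rewrite invr_gt0 sqrtr_gt0.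
  have -> : G = 0; last by rewrite mul0r.
  apply/eqP; rewrite eq_le G0 andbT.
  by rewrite -(ler_pM2l SN) mulr0; move: SG; rewrite R00 expr0n mulr0.
have {}R0pos : 0 < R0 by rewrite lt_def R0pos enorm_ge0.
(* The budget obtained is 16/3 R0^2; it is rounded up to 8 R0^2 because a power
   of two keeps the final comparison of constants elementary. *)
have B0 : 0 < 8 * R0 ^+ 2 by rewrite mulr_gt0// exprn_gt0.
have grow : N%:R `^ ((3 * p + 1)%:R / 2) <= kap * (8 * R0 ^+ 2) `^ (p.-1%:R / 2)
    * (p.+1%:R / 2) ^+ p.+1 * S N ^+ 2.
  apply: (@growth_rate R p N kap _ L (fun k => enorm (y k.+1 - x k))) => //.
    by move=> k kN; split; [have [[]] := step k kN|exact: enorm_ge0|exact: Lkap].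
  have -> : \sum_(k < N) S k.+1 ^+ 2 * L k * enorm (y k.+1 - x k) ^+ 2 =
      4 / 3 * \sum_(k < N) S k.+1 ^+ 2 * (3 / 4 * L k * enorm (y k.+1 - x k) ^+ 2).
    by rewrite mulr_sumr; apply: eq_bigr => k _; field.
  have := sqr_ge0 R0; lra.
have BE : (8 * R0 ^+ 2) `^ (p.-1%:R / 2) = 8 `^ (p.-1%:R / 2) * R0 ^+ p.-1.
  rewrite powRM// ?sqr_ge0//; congr (_ * _).
  rewrite -(powR_mulrn 2 (ltW R0pos)) -powRrM mulrC divfK//.
  by rewrite powR_mulrn// ltW.
apply: (le_trans (ler_wpM2l G0 grow)); rewrite BE.
set c8 := 8 `^ _; set cm := (_ / 2) ^+ _.
have c0 : 0 <= c8 * cm by rewrite mulr_ge0 ?powR_ge0// exprn_ge0// divr_ge0.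
have X0 : 0 <= R0 ^+ p.-1 by rewrite exprn_ge0// ltW.
have RE : R0 ^+ p.+1 = R0 ^+ p.-1 * R0 ^+ 2.
  by rewrite -exprD addn2 prednK.
rewrite [leLHS](_ : _ = (kap * (c8 * cm) * R0 ^+ p.-1) * (S N ^+ 2 * G)); last by ring.
apply: (@le_trans _ _ ((kap * (c8 * cm) * R0 ^+ p.-1) * (2 * R0 ^+ 2))).
  by rewrite ler_wpM2l// mulr_ge0// mulr_ge0// ltW.
have := @rate_constant_le R p p0; rewrite -/c8 -/cm /rate_const RE => cle.
rewrite [leLHS](_ : _ = c8 * 8 * cm * (p.+1%:R / p`!%:R * (M * (R0 ^+ p.-1 * R0 ^+ 2)))).
  rewrite [leRHS](_ : _ = 2 `^ ((3 * p.+1%:R ^+ 2 + 4) / 4) *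
     (p.+1%:R / p`!%:R * (M * (R0 ^+ p.-1 * R0 ^+ 2)))); last by ring.
  rewrite ler_wpM2r// mulr_ge0 ?divr_ge0// ?(ltW fac0)// mulr_ge0 ?(ltW M0)//.
  by rewrite mulr_ge0// sqr_ge0.
by rewrite /kap; ring.
Qed.

End OptimalTensorMethod.

(** * Restarts under uniform convexity *)

Section Restart.
Context {R : realType} {n : nat}.
Local Notation V := 'rV[R]_n.
Implicit Types (f : V -> R) (x y z xs : V) (M q sigma D : R).

(** The derivative in each direction and in its opposite is nonnegative. *)
Lemma grad_minimizer f xs h : (forall x, f xs <= f x) ->
  differentiable f xs -> dot (grad f xs) h = 0.
Proof.
move=> min df.
suff nn k : 0 <= 'D_k f xs.
  rewrite grad_dot//; apply/eqP; rewrite eq_le nn andbT.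
  by rewrite -oppr_ge0 -deriveNdir.
have dx : differentiable f (xs + 0 *: k) by rewrite scale0r addr0.
have := is_derive_line dx; rewrite scale0r addr0 => D.
apply: (derive_ge0_of_right_min D) => t _.
by rewrite scale0r addr0.
Qed.

Lemma uniform_growth q sigma f xs x : 0 < q ->
  (forall x, f xs <= f x) -> differentiable f xs ->
  uniformly_convex q sigma f ->
  sigma / q * enorm (x - xs) `^ q <= f x - f xs.
Proof.
move=> q0 min df ucv; have := ucv xs x.
by rewrite grad_minimizer// addr0 lerBrDl.
Qed.

Lemma max_ceil_bounds (X : R) : 0 <= X ->
  (0 < `|Num.max (Num.ceil X) 1|)%N /\
  X <= `|Num.max (Num.ceil X) 1|%N%:R <= X + 1.
Proof.
move=> X0.
have m1 : 1 <= Num.max (Num.ceil X) 1 by rewrite le_max lexx orbT.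
have E : `|Num.max (Num.ceil X) 1|%N%:R = (Num.max (Num.ceil X) 1)%:~R :> R.
  by rewrite natr_absz ger0_norm// (le_trans _ m1).
split; first by rewrite absz_gt0 gt_eqF// (lt_le_trans _ m1).
rewrite E; apply/andP; split.
  apply: le_trans (ceil_ge X) _; by rewrite ler_int le_max lexx.
have [c1|c1] := leP (Num.ceil X) 1; first by rewrite lerDr.
by have := ceilB1_lt X; lra.
Qed.

Section Steps.
Context (p : nat) (M q sigma D : R).
Context (M0 : 0 < M) (q0 : 0 < q) (D0 : 0 <= D).

Let X k : R := (2 * rate_const p * M * q `^ (p.+1%:R / q) / sigma `^ (p.+1%:R / q)
           * gap_bound D k `^ ((p.+1%:R - q) / q))
         `^ (2 / (3 * p + 1)%:R).

Lemma rate_const_gt0 : 0 < rate_const p :> R.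
Proof.
by rewrite /rate_const divr_gt0 ?ltr0n ?fact_gt0// mulr_gt0// powR_gt0.
Qed.

Lemma gap_bound_ge0 k : 0 <= gap_bound D k.
Proof. by rewrite mulr_ge0// invr_ge0 exprn_ge0. Qed.

Lemma restart_steps_gt0 k : (0 < restart_steps p M q sigma D k)%N.
Proof. by case: (@max_ceil_bounds (X k) (powR_ge0 _ _)). Qed.

Lemma restart_steps_ge k :
  2 * rate_const p * M * q `^ (p.+1%:R / q) / sigma `^ (p.+1%:R / q)
     * gap_bound D k `^ ((p.+1%:R - q) / q)
  <= (restart_steps p M q sigma D k)%:R `^ ((3 * p + 1)%:R / 2).
Proof.
have [_ /andP[+ _]] := @max_ceil_bounds (X k) (powR_ge0 _ _).
have e0 : 0 <= (3 * p + 1)%:R / 2 :> R by rewrite divr_ge0.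
move/(ge0_ler_powR e0); rewrite !nnegrE powR_ge0 ler0n => /(_ isT isT).
rewrite /X -powRrM -[(3 * p + 1)%:R / 2]invf_div mulfV; last first.
  by rewrite mulf_neq0 ?invr_eq0 ?pnatr_eq0// addn1.
rewrite powRr1// mulr_ge0 ?powR_ge0// divr_ge0 ?powR_ge0// mulr_ge0 ?powR_ge0//.
by rewrite mulr_ge0 ?(ltW M0)// mulr_ge0// ltW// rate_const_gt0.
Qed.

Lemma restart_steps_le k :
  (restart_steps p M q sigma D k)%:R <=
  (2 * rate_const p * q `^ (p.+1%:R / q)) `^ (2 / (3 * p + 1)%:R)
         * (M `^ (2 / (3 * p + 1)%:R)
            / sigma `^ (2 * p.+1%:R / (q * (3 * p + 1)%:R)))
         * D `^ (2 * (p.+1%:R - q) / (q * (3 * p + 1)%:R))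
         * 2 `^ (- (k%:R * (2 * (p.+1%:R - q) / (q * (3 * p + 1)%:R)))) + 1.
Proof.
have [_ /andP[_ H]] := @max_ceil_bounds (X k) (powR_ge0 _ _).
apply: (le_trans H); rewrite lerD2r /X.
have c0 := rate_const_gt0.
have n0 : (3 * p + 1)%:R != 0 :> R by rewrite pnatr_eq0 addn1.
move: ((3 * p + 1)%:R : R) n0 => n3 n0; set e := 2 / n3.
have -> : 2 * p.+1%:R / (q * n3) = p.+1%:R / q * e.
  by rewrite /e; field; rewrite n0 gt_eqF.
have -> : 2 * (p.+1%:R - q) / (q * n3) = (p.+1%:R - q) / q * e.
  by rewrite /e; field; rewrite n0 gt_eqF.
set t := (_ - q) / q; set Q := q `^ _.
have Q0 : 0 <= Q by exact: powR_ge0.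
rewrite /gap_bound -powR_invn// (powRM _ D0 (powR_ge0 _ _)).
rewrite -(powRrM 2).
have -> : 2 * rate_const p * M * Q / sigma `^ (p.+1%:R / q)
    * (D `^ t * 2 `^ (- k%:R * t)) =
  2 * rate_const p * Q * (M * sigma `^ (- (p.+1%:R / q))) * D `^ t * 2 `^ (- k%:R * t).
  by rewrite powRN; ring.
have K0 : 0 <= 2 * rate_const p * Q by rewrite mulr_ge0// mulr_ge0// ltW.
have Ms0 : 0 <= M * sigma `^ (- (p.+1%:R / q)).
  by rewrite mulr_ge0 ?powR_ge0// ltW.
rewrite (powRM _ (mulr_ge0 (mulr_ge0 K0 Ms0) (powR_ge0 _ _)) (powR_ge0 _ _)).
rewrite (powRM _ (mulr_ge0 K0 Ms0) (powR_ge0 _ _)).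
rewrite (powRM _ K0 Ms0) (powRM _ (ltW M0) (powR_ge0 _ _)).
by rewrite -!powRrM !mulNr (mulrA k%:R) !powRN.
Qed.

End Steps.

Lemma sum_restart_steps_le p M q sigma D k :
  0 < M -> 0 < q -> 0 < sigma -> 0 <= D ->
  (\sum_(0 <= i < k) restart_steps p M q sigma D i)%N%:R
      <= (2 * rate_const p * q `^ (p.+1%:R / q)) `^ (2 / (3 * p + 1)%:R)
         * (M `^ (2 / (3 * p + 1)%:R)
            / sigma `^ (2 * p.+1%:R / (q * (3 * p + 1)%:R)))
         * D `^ (2 * (p.+1%:R - q) / (q * (3 * p + 1)%:R))
         * \sum_(0 <= i < k.+1)
             2 `^ (- (i%:R * (2 * (p.+1%:R - q) / (q * (3 * p + 1)%:R))))
         + k%:R.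
Proof.
move=> M0 q0 s0 D0.
set K := (X in _ <= X * _ + _).
have K0 : 0 <= K.
  by rewrite mulr_ge0 ?powR_ge0// mulr_ge0 ?powR_ge0// divr_ge0 ?powR_ge0.
have -> : k%:R = \sum_(0 <= i < k) (1 : R) by rewrite sumr_const_nat subn0.
rewrite big_nat_recr//= mulrDr addrAC mulr_sumr -big_split /= natr_sum.
apply: ler_wpDr; first by rewrite mulr_ge0 ?powR_ge0.
by apply: ler_sum => i _; exact: restart_steps_le.
Qed.

(** By uniform growth the (p+1)-st power of the distance from z k to the
    minimizer is at most (q/sigma * gap)^((p+1)/q), and the definition of the
    number of steps makes the rate bound at most half the gap bound.  Splitting
    off one factor gap from gap^((p+1)/q) avoids dividing by a gap that may
    be zero. *)
Lemma restart_halves p M q sigma D f xs (z : nat -> V) k : (0 < p)%N ->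
  times_differentiable p f -> 0 < M -> lipschitz_nabla p M f ->
  0 < q -> 0 < sigma -> uniformly_convex q sigma f ->
  (forall x, f xs <= f x) ->
  f (z 0%N) - f xs <= D ->
  restarted_tensor_run f p M q sigma D z ->
  f (z k) - f xs <= gap_bound D k.
Proof.
move=> p0 tf M0 lip q0 s0 ucv min D0 run.
have df x := times_differentiable_differentiable x p0 tf.
have D0' : 0 <= D by apply: le_trans D0; rewrite subr_ge0.
elim: k => [|k IH]; first by rewrite /gap_bound expr0 invr1 mulr1.
have gE : gap_bound D k.+1 = gap_bound D k / 2.
  by rewrite /gap_bound exprS invfM mulrA mulrAC.
have cvx x y := uniformly_convex_above_tangent x y q0 s0 ucv.
have N0 := restart_steps_gt0 p M q sigma D k.
have Nge := @restart_steps_ge p M q sigma D M0 k.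
have := optimal_tensor_rate p0 N0 tf M0 lip cvx min (run k).
set Nn := (restart_steps _ _ _ _ _ _)%:R `^ _ in Nge *.
have Nn0 : 0 < Nn by rewrite powR_gt0// ltr0n.
set r := enorm (z k - xs); set m : R := p.+1%:R.
have r0 : 0 <= r by exact: enorm_ge0.
have gk := gap_bound_ge0 D0' k.
have rq : r `^ q <= q / sigma * gap_bound D k.
  have := le_trans (uniform_growth (z k) q0 min (df xs) ucv) IH.
  rewrite -/r -(ler_pM2l (divr_gt0 q0 s0)).
  rewrite [leLHS](_ : _ = r `^ q)//.
  by field; rewrite !gt_eqF.
have rm : r ^+ p.+1 <= (q / sigma) `^ (m / q) * gap_bound D k `^ (m / q).
  have mq0 : 0 <= m / q by rewrite divr_ge0// ltW.
  have := ge0_ler_powR mq0 _ _ rq; rewrite !nnegrE powR_ge0 mulr_ge0//; last first.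
    by rewrite divr_ge0// ltW.
  move=> /(_ isT isT); rewrite -powRrM mulrC divfK ?gt_eqF// powR_mulrn//.
  by rewrite powRM// divr_ge0// ltW.
have c0 : 0 < rate_const p :> R := @rate_const_gt0 p.
move=> H; rewrite gE -(ler_pM2r Nn0); apply: (le_trans H).
apply: (@le_trans _ _ (rate_const p * M
    * ((q / sigma) `^ (m / q) * gap_bound D k `^ (m / q)))).
  by rewrite ler_wpM2l// mulr_ge0// ltW.
apply: le_trans (ler_wpM2l (divr_ge0 gk (ler0n _ 2)) Nge).
rewrite -/m powRM ?(ltW q0) ?invr_ge0 ?(ltW s0)//.
have -> : sigma^-1 `^ (m / q) = (sigma `^ (m / q))^-1.
  by rewrite -(powR_inv1 (ltW s0)) -powRrM mulN1r powRN.
have -> : gap_bound D k `^ (m / q) =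
    gap_bound D k * gap_bound D k `^ ((m - q) / q).
  rewrite mulrBl divff ?gt_eqF//.
  by rewrite mulr_powRB1 ?divr_gt0 ?ltr0n.
by rewrite le_eqVlt; apply/orP; left; apply/eqP; field; rewrite gt_eqF// powR_gt0.
Qed.

End Restart.

Theorem theorem4 (R : realType) (n p : nat) (f : 'rV[R]_n -> R)
    (M q sigma Delta0 : R) (xs : 'rV[R]_n) (z : nat -> 'rV[R]_n) :
  (1 <= p)%N ->
  @convex_function R 'rV[R]_n setT f ->
  times_differentiable p f ->
  0 < M -> lipschitz_nabla p M f ->
  2 <= q <= p.+1%:R ->
  0 < sigma -> uniformly_convex q sigma f ->
  (forall x, f xs <= f x) ->
  f (z 0%N) - f xs <= Delta0 ->
  restarted_tensor_run f p M q sigma Delta0 z ->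
  forall k : nat,
    (sigma / q * enorm (z k - xs) `^ q <= f (z k) - f xs /\
     f (z k) - f xs <= Delta0 * 2 ^- k) /\
    (\sum_(0 <= i < k) restart_steps p M q sigma Delta0 i)%N%:R
      <= (2 * rate_const p * q `^ (p.+1%:R / q)) `^ (2 / (3 * p + 1)%:R)
         * (M `^ (2 / (3 * p + 1)%:R)
            / sigma `^ (2 * p.+1%:R / (q * (3 * p + 1)%:R)))
         * Delta0 `^ (2 * (p.+1%:R - q) / (q * (3 * p + 1)%:R))
         * \sum_(0 <= i < k.+1)
             2 `^ (- (i%:R * (2 * (p.+1%:R - q) / (q * (3 * p + 1)%:R))))
         + k%:R.
Proof.
move=> p0 _ tf M0 lip /andP[q2 _] s0 ucv min D0 run k.
have q0 : 0 < q by exact: lt_le_trans q2.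
have df x := times_differentiable_differentiable x p0 tf.
split; last first.
  by apply: sum_restart_steps_le => //; apply: le_trans D0; rewrite subr_ge0.
split; first exact: uniform_growth.
exact: (restart_halves k p0 tf M0 lip q0 s0 ucv min D0 run).
Qed.
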